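(* There exist a real-valued continuous function $f\in C(\mathbb{T}^2)$ and a complete sequence of regions $\Delta_k$, $k=1,2,\ldots$, each of the form $\Delta_k=\Delta(a_k,b_k)$ with $a_k,b_k>0$, such that $\Delta_k\subset\Delta_{k+1}$ for all $k$, $\rho(\Delta_k)\to 1$ as $k\to\infty$, and $$\limsup_{k\to\infty}|S_{\Delta_k}(x,y,f)|=\infty$$ for almost every $(x,y)\in\mathbb{T}^2$.
   Context: $\mathbb{T}=\mathbb{R}/(2\pi\mathbb{Z})$, $\mathbb{T}^2=\mathbb{T}\times\mathbb{T}$, with Lebesgue measure. For $f\in L^1(\mathbb{T}^2)$ with double Fourier series $\sum_{n,m=-\infty}^{+\infty}c_{nm}e^{i(nx+my)}$ and a bounded region $G\subset\mathbb{R}^2$, the partial sum over $G$ is $$S_G(x,y,f)=\sum_{(n,m)\in G}c_{nm}e^{i(nx+my)}$$ (the sum is over integer points $(n,m)\in\mathbb{Z}^2\cap G$). For $a,b>0$, $$\Delta(a,b)=\{(x,y)\in\mathbb{R}^2:\ a|x|+b|y|\le 1\},\qquad \rho(\Delta(a,b))=\frac{\max\{a,b\}}{\min\{a,b\}}.$$ A sequence of regions $G_k$ is complete if $\bigcup_{k=1}^\infty G_k=\mathbb{R}^2$. *)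

(* Defs.v *)
From HB Require Import structures.
From mathcomp Require Import all_boot all_order all_algebra.
From mathcomp Require Import all_classical all_reals all_analysis.
From mathcomp Require Import complex.

Set Implicit Arguments.
Unset Strict Implicit.
Unset Printing Implicit Defensive.

Import Order.TTheory GRing.Theory Num.Theory.
Import numFieldNormedType.Exports.

Local Open Scope classical_set_scope.
Local Open Scope ring_scope.
Local Open Scope complex_scope.

Section Torus.
Context {R : realType}.

(* Functions on the torus (R / 2 pi Z)^2 are represented by functions on the
   plane that are 2 pi-periodic in each variable; its Lebesgue measure is planar
   Lebesgue measure on the fundamental square [0, 2 pi)^2. *)
Definition biperiodic (V : Type) (f : R * R -> V) : Prop :=
  forall x y : R, f (x + 2 * pi, y) = f (x, y) /\ f (x, y + 2 * pi) = f (x, y).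

Definition torus : set (R * R) := `[0, 2 * pi[ `*` `[0, 2 * pi[.

Definition lebesgue2 := ((@lebesgue_measure R) \x (@lebesgue_measure R))%E.

Definition torus_integral (f : R * R -> R[i]) : R[i] :=
  (\int[lebesgue2]_(p in torus) complex.Re (f p))%R
  +i* (\int[lebesgue2]_(p in torus) complex.Im (f p))%R.

Definition expi (t : R) : R[i] := cos t +i* sin t.

Definition character (nm : int * int) (p : R * R) : R[i] :=
  expi (nm.1%:~R * p.1 + nm.2%:~R * p.2).

Definition fourier_coef (f : R * R -> R[i]) (nm : int * int) : R[i] :=
  ((4 * pi ^+ 2)^-1)%:C *
  torus_integral (fun p => f p * character (- nm.1, - nm.2) p).

(* The finitely supported sum \sum_(_ \in _) is the intended sum only for
   bounded G, which contains finitely many lattice points. *)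
Definition partial_sum (G : set (R * R)) (p : R * R) (f : R * R -> R[i]) :
    R[i] :=
  \sum_(nm \in [set nm : int * int | G (nm.1%:~R, nm.2%:~R)])
    fourier_coef f nm * character nm p.

Definition Delta (a b : R) : set (R * R) :=
  [set p | a * `|p.1| + b * `|p.2| <= 1].

Definition rho_Delta (a b : R) : R := Num.max a b / Num.min a b.

Definition complete_regions (G : nat -> set (R * R)) : Prop :=
  \bigcup_k G k = setT.

End Torus.

(* Main.v *)
(** The function is a sum of blocks 2^-j P_j, where P_j is a trigonometric
    polynomial bounded by 1 whose partial sums over some finite chain of rhombi
    are large off a set of small measure; the spectra of the blocks and the
    chains are interlaced, so that on the j-th chain the later blocks do not
    contribute and the earlier ones are reproduced.

    All the rhombi of a chain share the vertex (N, 0), and their sides through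
    it, of slopes close to -1, cut the plane around (N, 0) into sectors. To each
    node of a binary tree of height n, taken in in-order, corresponds a sector
    and in it one frequency, whose distance to (N, 0) grows fast with the depth:
    the rhombi cut the tree in its in-order, whereas orthogonality and
    independence are governed by the depth. The polynomial is Re (e^{iNx} X_n),
    where, with z_l equal to the exponential of the current node,
      X_{l+1} = X_l + c (1 - |X_l|^2) z_l,     c of order 1 / sqrt n,
    stays in the unit disc, and the next node is the right child of the current
    one when Re z_l > 0 (smoothed to a polynomial) and the left one otherwise.
    A cut just after the final leaf keeps exactly the steps that were followed
    by a move to the right, all of which have Re z_l > 0: they add up to order
    c n = sqrt n, up to a martingale bounded in L^2. *)

Require Import Defs.
From HB Require Import structures.
From mathcomp Require Import all_boot all_order all_algebra.
From mathcomp Require Import all_classical all_reals all_analysis.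
From mathcomp Require Import complex measurable_realfun.
From mathcomp Require Import ring lra zify.

Set Implicit Arguments.
Unset Strict Implicit.
Unset Printing Implicit Defensive.

Import Order.TTheory GRing.Theory Num.Theory.
Import numFieldNormedType.Exports.

Local Open Scope classical_set_scope.
Local Open Scope ring_scope.
Local Open Scope complex_scope.

(** * Bounded measurable functions on the torus and their normalized mean *)

Section Mean.
Context {R : realType}.
Implicit Types (u v : R * R -> R) (p : R * R).

(** A class stable under sums and products on which integrability is automatic, so that linearity of
    [mean] needs no other side condition. *)
Definition bmeas u := measurable_fun setT u /\ exists B : R, forall p, `|u p| <= B.

Definition mean u : R := (4 * pi ^+ 2)^-1 * (\int[lebesgue2]_(p in torus) u p)%R.

Lemma twopi_gt0 : 0 < 2 * pi :> R.
Proof. by rewrite mulr_gt0// pi_gt0. Qed.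

Lemma measurable_torus : measurable (torus : set (R * R)).
Proof. by apply: measurableX; exact: measurable_itv. Qed.

Lemma lebesgue2_torus : @lebesgue2 R torus = (4 * pi ^+ 2)%:E.
Proof.
rewrite /lebesgue2 /torus product_measure1E; [|exact: measurable_itv..].
rewrite /=; set m := (X in (X * X)%E).
have -> : m = (2 * pi)%:E.
  by rewrite /m lebesgue_measure_itv/= lte_fin twopi_gt0 oppr0 adde0.
by rewrite -EFinM; congr (_%:E); ring.
Qed.

Lemma bmeas_integrable u : bmeas u -> lebesgue2.-integrable torus (EFin \o u).
Proof.
move=> [mu [B uB]]; apply: measurable_bounded_integrable.
- exact: measurable_torus.
- by have := ltry (4 * pi ^+ 2 : R); rewrite -lebesgue2_torus.
- exact: measurable_funTS.
- by exists B; split; [exact: num_real|move=> M BM p _ /=; exact: le_trans (ltW BM)].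
Qed.

Lemma bmeas_cst (c : R) : bmeas (fun=> c).
Proof. by split; [exact: measurable_cst|exists `|c|]. Qed.

Lemma bmeasD u v : bmeas u -> bmeas v -> bmeas (fun p => u p + v p).
Proof.
move=> [mu [B uB]] [mv [C vC]]; split; first exact: measurable_funD.
by exists (B + C) => p; rewrite (le_trans (ler_normD _ _))// lerD.
Qed.

Lemma bmeasM u v : bmeas u -> bmeas v -> bmeas (fun p => u p * v p).
Proof.
move=> [mu [B uB]] [mv [C vC]]; split; first exact: measurable_funM.
by exists (B * C) => p; rewrite normrM ler_pM.
Qed.

Lemma bmeasN u : bmeas u -> bmeas (fun p => - u p).
Proof.
by move=> bu; under eq_fun do rewrite -mulN1r; apply: bmeasM => //; exact: bmeas_cst.
Qed.

Lemma bmeasB u v : bmeas u -> bmeas v -> bmeas (fun p => u p - v p).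
Proof. by move=> bu bv; apply: bmeasD => //; exact: bmeasN. Qed.

Lemma bmeas_sum (I : Type) (s : seq I) (F : I -> R * R -> R) :
  (forall i, bmeas (F i)) -> bmeas (fun p => \sum_(i <- s) F i p).
Proof.
move=> bF; elim: s => [|i s IH].
  by under eq_fun do rewrite big_nil; exact: bmeas_cst.
by under eq_fun do rewrite big_cons; exact: bmeasD.
Qed.

Lemma meanD u v : bmeas u -> bmeas v ->
  mean (fun p => u p + v p) = mean u + mean v.
Proof.
move=> bu bv; rewrite /mean RintegralD ?mulrDr//; [exact: measurable_torus|..];
  exact: bmeas_integrable.
Qed.

Lemma meanZ c u : bmeas u -> mean (fun p => c * u p) = c * mean u.
Proof.
move=> bu; rewrite /mean RintegralZl; [|exact: measurable_torus|exact: bmeas_integrable].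
by rewrite mulrCA.
Qed.

Lemma mean_cst c : mean (fun=> c) = c.
Proof.
rewrite /mean Rintegral_cst; last exact: measurable_torus.
have pi0 : pi != 0 :> R by rewrite gt_eqF// pi_gt0.
rewrite [fine _](congr1 fine lebesgue2_torus)/=.
by move: (pi : R) pi0 => q q0; field.
Qed.

Lemma meanN u : bmeas u -> mean (fun p => - u p) = - mean u.
Proof. by move=> bu; under eq_fun do rewrite -mulN1r; rewrite meanZ// mulN1r. Qed.

Lemma meanB u v : bmeas u -> bmeas v ->
  mean (fun p => u p - v p) = mean u - mean v.
Proof. by move=> bu bv; rewrite meanD ?meanN//; exact: bmeasN. Qed.

Lemma mean_sum (I : Type) (s : seq I) (F : I -> R * R -> R) :
  (forall i, bmeas (F i)) ->
  mean (fun p => \sum_(i <- s) F i p) = \sum_(i <- s) mean (F i).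
Proof.
move=> bF; elim: s => [|i s IH].
  by under eq_fun do rewrite big_nil; rewrite mean_cst big_nil.
by under eq_fun do rewrite big_cons; rewrite meanD ?IH ?big_cons//; exact: bmeas_sum.
Qed.

Lemma ler_mean u v : bmeas u -> bmeas v -> (forall p, u p <= v p) ->
  mean u <= mean v.
Proof.
move=> bu bv uv; rewrite /mean ler_wpM2l//; first by rewrite invr_ge0 mulr_ge0 ?sqr_ge0.
by apply: le_Rintegral => //; [exact: measurable_torus|exact: bmeas_integrable..].
Qed.

Lemma mean_norm_le u (B : R) : bmeas u -> (forall p, `|u p| <= B) -> `|mean u| <= B.
Proof.
move=> bu uB; rewrite ler_norml -{1}(mean_cst (- B)) -{2}(mean_cst B).
have uBp p : - B <= u p <= B by rewrite -ler_norml.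
by apply/andP; split; apply: ler_mean => //; try exact: bmeas_cst; move=> p; case/andP: (uBp p).
Qed.

Lemma continuous_cos_affine (c k : R) : continuous (fun t : R => cos (c + k * t)).
Proof.
move=> t; apply: (@continuous_comp _ _ _ (fun t : R => c + k * t) cos); last exact: continuous_cos.
by apply: cvgD; [exact: cvg_cst|apply: cvgM; [exact: cvg_cst|exact: cvg_id]].
Qed.

Lemma measurable_cos_affine (c k : R) :
  measurable_fun setT (fun t : R => cos (c + k * t)).
Proof. by apply: continuous_measurable_fun; exact: continuous_cos_affine. Qed.

Lemma sin_shift (c : R) (m : int) : sin (c + m%:~R * (2 * pi)) = sin c.
Proof.
have E n x : sin (x + n%:R * (2 * pi)) = sin x :> R.
  by rewrite -[RHS](periodicn (@sinD2pi R) n x) mulr_natl mulr_natl.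
case: m => n; first exact: E.
by rewrite -(E n.+1) -addrA -mulrDl NegzE mulrNz addNr mul0r addr0.
Qed.

Lemma cos_shift (c : R) (m : int) : cos (c + m%:~R * (2 * pi)) = cos c.
Proof. by rewrite -!sinDpihalf addrAC sin_shift. Qed.

(** The antiderivative is a multiple of a sine taking the same value at both ends of the period. The
    shift [c] covers sines, and cosines with the other variable frozen. *)
Lemma integral_cos_affine (c : R) (m : int) : m != 0 ->
  (\int[lebesgue_measure]_(t in `[0%R, (2 * pi)%R[) (cos (c + m%:~R * t))%:E = 0)%E.
Proof.
move=> m0; have m0' : m%:~R != 0 :> R by rewrite intr_eq0.
rewrite integral_itv_bndo_bndc; last first.
  by apply/measurable_EFinP; apply: measurable_funTS; exact: measurable_cos_affine.
pose F (t : R) := m%:~R^-1 * sin (c + m%:~R * t).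
have dF (t : R) : is_derive t 1 F (cos (c + m%:~R * t)).
  rewrite /F; apply: is_derive_eq; rewrite /GRing.scale/=.
  by rewrite add0r mul1r mulr1 mulrCA mulVf// mulr1.
have cF : continuous F.
  by move=> t; apply: differentiable_continuous; apply/derivable1_diffP; apply: ex_derive.
rewrite (@continuous_FTC2 _ _ F).
- rewrite -EFinB /F mulr0 addr0.
  by rewrite sin_shift subrr.
- exact: twopi_gt0.
- by apply: continuous_subspaceT; exact: continuous_cos_affine.
- split; [by move=> t _; apply: ex_derive|..].
  + by apply: cvg_at_right_filter; exact: cF.
  + by apply: cvg_at_left_filter; exact: cF.
- by move=> t _; rewrite derive1E; apply: derive_val.
Qed.

Lemma measurable_cos_affine2 (c k l : R) :
  measurable_fun setT (fun p : R * R => cos (c + (k * p.1 + l * p.2))).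
Proof.
apply: (measurableT_comp (f := @cos R)).
  by apply: continuous_measurable_fun; exact: continuous_cos.
apply: measurable_funD => //; apply: measurable_funD; apply: measurable_funM => //.
Qed.

Lemma bmeas_cos (c k l : R) : bmeas (fun p => cos (c + (k * p.1 + l * p.2))).
Proof.
split; first exact: measurable_cos_affine2.
by exists 1 => p; rewrite ler_norml cos_geN1 cos_le1.
Qed.

Lemma mean_cos (c : R) (k : int * int) : k != (0, 0) ->
  mean (fun p => cos (c + (k.1%:~R * p.1 + k.2%:~R * p.2))) = 0.
Proof.
move=> k0; pose f : R * R -> R := fun p => cos (c + (k.1%:~R * p.1 + k.2%:~R * p.2)).
have fi := bmeas_integrable (bmeas_cos c k.1%:~R k.2%:~R).
suff E : (\int[lebesgue2]_(p in torus) (f p)%:E = 0)%E.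
  by rewrite /mean /Rintegral [X in fine X]E mulr0.
pose A : set R := [set` `[(0 : R), 2 * pi[].
(* The indicator of the square is a product of two indicators, which is the form that Fubini
   needs. *)
have patchf x y : ((EFin \o f) \_ torus) (x, y) = 
   ((fun x => ((fun y => (f (x, y))%:E) \_ A) y) \_ A) x.
  rewrite !patchE/= /torus in_setX -/A/=.
  by case: (x \in A); case: (y \in A).
have fi' : (lebesgue_measure \x lebesgue_measure)%E.-integrable setT ((EFin \o f) \_ torus).
  by rewrite -integrable_mkcond//; exact: measurable_torus.
rewrite integral_mkcond.
(* The order of integration is chosen so that the inner variable has a nonzero frequency. *)
have [k20|k20] := eqVneq k.2 0.
  have k10 : k.1 != 0 by move: k0; case: (k) k20 => a b /= ->; rewrite xpair_eqE eqxx andbT.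
  rewrite /lebesgue2 -(integral21_prod_meas1 fi') /fubini_G integral0_eq// => y _.
  under eq_integral do rewrite patchf.
  rewrite -integral_mkcond.
  have [yA|yA] := boolP (y \in A); last first.
    by apply: integral0_eq => x _; rewrite patchE (negbTE yA).
  rewrite -[RHS](integral_cos_affine (c + k.2%:~R * y) k10).
  by apply: eq_integral => x _; rewrite patchE yA /f addrCA addrC.
rewrite /lebesgue2 -(integral12_prod_meas1 fi') /fubini_F integral0_eq// => x _.
under eq_integral do rewrite patchf.
have [xA|xA] := boolP (x \in A); last first.
  by apply: integral0_eq => y _; rewrite patchE (negbTE xA).
rewrite -[RHS](integral_cos_affine (c + k.1%:~R * x) k20).
rewrite [RHS]integral_mkcond; apply: eq_integral => y _.
by rewrite patchE xA !patchE /f/= addrA.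
Qed.

End Mean.

(** * Trigonometric polynomials, their spectra and their Fourier coefficients *)

Section Trig.
Context {R : realType}.
Implicit Types (S T V : set (int * int)) (F G : R * R -> R[i]) (p : R * R).
Implicit Types (k l : int * int).

Local Notation chr := (@character R).
Local Notation nrm := (@Normc.normc R).

(** Trigonometric polynomials with spectrum in [S]. As a closure of characters under linear
    combinations, with no list of coefficients, they allow spectral facts to be proved by induction
    on the derivation. *)
Inductive trig S : (R * R -> R[i]) -> Prop :=
| trig_chr k of S k : trig S (chr k)
| trig0 : trig S (fun=> 0)
| trigD F G of trig S F & trig S G : trig S (fun p => F p + G p)
| trigZ (c : R[i]) F of trig S F : trig S (fun p => c * F p).

Lemma expiD (s t : R) : expi (s + t) = expi s * expi t.
Proof. by rewrite /expi cosD sinD; apply/eqP; rewrite eq_complex/= addrC !eqxx /= addrC. Qed.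

Lemma expi0 : expi 0 = 1 :> R[i].
Proof. by rewrite /expi cos0 sin0. Qed.

Lemma expiN (t : R) : expi (- t) = (expi t)^*.
Proof. by rewrite /expi cosN sinN. Qed.

Lemma chr0 p : chr 0 p = 1.
Proof. by rewrite /character/= !mul0r addr0 expi0. Qed.

Lemma chrD k l p : chr (k + l) p = chr k p * chr l p.
Proof.
rewrite /character -expiD; congr expi.
by rewrite /= !intrD !mulrDl addrACA.
Qed.

Lemma chrN k p : chr (- k) p = (chr k p)^*.
Proof. by rewrite /character -expiN; congr expi; rewrite /= !intrN !mulNr opprD. Qed.

Lemma sqr_nrm (z : R[i]) : nrm z ^+ 2 = complex.Re z ^+ 2 + complex.Im z ^+ 2.
Proof. by case: z => a b /=; rewrite sqr_sqrtr// addr_ge0// sqr_ge0. Qed.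

Lemma nrm_ge0 (z : R[i]) : 0 <= nrm z.
Proof. by case: z => a b /=; exact: sqrtr_ge0. Qed.

Lemma nrm_chr k p : nrm (chr k p) = 1.
Proof. by rewrite /character /expi /= cos2Dsin2 sqrtr1. Qed.

Lemma nrm_real (x : R) : nrm x%:C = `|x|.
Proof. by rewrite /= expr0n addr0 sqrtr_sqr. Qed.

Lemma ler_Re_nrm (z : R[i]) : `|complex.Re z| <= nrm z.
Proof.
rewrite -[nrm z]ger0_norm ?nrm_ge0// -ler_sqr ?nnegrE// -!normrX !ger0_norm ?sqr_ge0//.
by rewrite sqr_nrm lerDl sqr_ge0.
Qed.

Lemma ler_Im_nrm (z : R[i]) : `|complex.Im z| <= nrm z.
Proof.
rewrite -[nrm z]ger0_norm ?nrm_ge0// -ler_sqr ?nnegrE// -!normrX !ger0_norm ?sqr_ge0//.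
by rewrite sqr_nrm lerDr sqr_ge0.
Qed.

Lemma mulcJ (z : R[i]) : z * z^* = (nrm z ^+ 2)%:C.
Proof.
by rewrite sqr_nrm; case: z => a b; apply/eqP; rewrite eq_complex/=;
  apply/andP; split; apply/eqP; ring.
Qed.

Lemma ReDc (z w : R[i]) : complex.Re (z + w) = complex.Re z + complex.Re w.
Proof. by case: z w => [a b] [c d]. Qed.

Lemma ImDc (z w : R[i]) : complex.Im (z + w) = complex.Im z + complex.Im w.
Proof. by case: z w => [a b] [c d]. Qed.

Lemma ReMc (z w : R[i]) :
  complex.Re (z * w) = complex.Re z * complex.Re w - complex.Im z * complex.Im w.
Proof. by case: z w => [a b] [c d]. Qed.

Lemma ImMc (z w : R[i]) :
  complex.Im (z * w) = complex.Re z * complex.Im w + complex.Im z * complex.Re w.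
Proof. by case: z w => [a b] [c d]. Qed.

Lemma nrm_sum (I : Type) (s : seq I) (P : pred I) (f : I -> R[i]) :
  nrm (\sum_(i <- s | P i) f i) <= \sum_(i <- s | P i) nrm (f i).
Proof.
elim/big_ind2 : _ => //; first by rewrite Normc.normc0.
by move=> z x w y zx wy; rewrite (le_trans (le_normcD _ _))// lerD.
Qed.

Lemma trigS S T F : S `<=` T -> trig S F -> trig T F.
Proof.
move=> ST; elim => [k Sk||F1 F2 _ ? _ ?|c F1 _ ?].
- by constructor; exact: ST.
- exact: trig0.
- exact: trigD.
- exact: trigZ.
Qed.

Lemma trig_cst S (c : R[i]) : S 0 -> trig S (fun=> c).
Proof.
move=> S0; rewrite (_ : (fun=> c) = fun p => c * chr 0 p).
  by apply: trigZ; exact: trig_chr.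
by apply/funext => p; rewrite chr0 mulr1.
Qed.

Lemma trigN S F : trig S F -> trig S (fun p => - F p).
Proof. by move=> tF; under eq_fun do rewrite -mulN1r; exact: trigZ. Qed.

Lemma trigB S F G : trig S F -> trig S G -> trig S (fun p => F p - G p).
Proof. by move=> tF tG; apply: trigD => //; exact: trigN. Qed.

Lemma trig_sum S (I : Type) (s : seq I) (P : pred I) (f : I -> R * R -> R[i]) :
  (forall i, P i -> trig S (f i)) -> trig S (fun p => \sum_(i <- s | P i) f i p).
Proof.
move=> tf; elim: s => [|i s IH].
  by under eq_fun do rewrite big_nil; exact: trig0.
have [Pi|Pi] := boolP (P i); under eq_fun do rewrite big_cons ?Pi ?(negbTE Pi).
  by apply: trigD; [exact: tf|exact: IH].
exact: IH.
Qed.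

Lemma trigM S T V F G : trig S F -> trig T G ->
  (forall k l, S k -> T l -> V (k + l)) -> trig V (fun p => F p * G p).
Proof.
move=> tF tG STV; elim: tF => [k Sk||F1 F2 _ ? _ ?|c F1 _ ?].
- elim: tG => [l Tl||G1 G2 _ ? _ ?|c G1 _ ?].
  + by under eq_fun do rewrite -chrD; constructor; exact: STV.
  + by under eq_fun do rewrite mulr0; exact: trig0.
  + by under eq_fun do rewrite mulrDr; exact: trigD.
  + by under eq_fun do rewrite mulrCA; exact: trigZ.
- by under eq_fun do rewrite mul0r; exact: trig0.
- by under eq_fun do rewrite mulrDl; exact: trigD.
- by under eq_fun do rewrite -mulrA; exact: trigZ.
Qed.

Lemma trigJ S F : trig S F -> trig [set k | S (- k)] (fun p => (F p)^*).
Proof.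
elim => [k Sk||F1 F2 _ ? _ ?|c F1 _ ?].
- under [X in trig _ X]eq_fun do rewrite -chrN.
  by constructor; rewrite /= opprK.
- by under [X in trig _ X]eq_fun do rewrite conjc0; exact: trig0.
- by under [X in trig _ X]eq_fun do rewrite rmorphD; exact: trigD.
- by under [X in trig _ X]eq_fun do rewrite rmorphM; exact: trigZ.
Qed.

Lemma eq_trig S F G : F =1 G -> trig S F -> trig S G.
Proof. by move=> /funext ->. Qed.

Definition cbmeas F :=
  bmeas (fun p => complex.Re (F p)) /\ bmeas (fun p => complex.Im (F p)).

Lemma sin_cosB (t : R) : sin t = cos (- (pi / 2) + t).
Proof. by rewrite addrC cosBpihalf. Qed.

Lemma cbmeas_chr k : cbmeas (chr k).
Proof.
split.
  rewrite (_ : (fun p => _) =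
    fun p => cos (0 + (k.1%:~R * p.1 + k.2%:~R * p.2))); first exact: bmeas_cos.
  by apply/funext => p; rewrite add0r.
rewrite (_ : (fun p => _) = fun p =>
  cos (- (pi / 2) + (k.1%:~R * p.1 + k.2%:~R * p.2))); first exact: bmeas_cos.
by apply/funext => p; rewrite -sin_cosB.
Qed.

Lemma cbmeasD F G : cbmeas F -> cbmeas G -> cbmeas (fun p => F p + G p).
Proof.
move=> [? ?] [? ?]; split.
  by under eq_fun do rewrite ReDc; exact: bmeasD.
by under eq_fun do rewrite ImDc; exact: bmeasD.
Qed.

Lemma cbmeasM F G : cbmeas F -> cbmeas G -> cbmeas (fun p => F p * G p).
Proof.
move=> [? ?] [? ?]; split.
  by under eq_fun do rewrite ReMc; apply: bmeasB; exact: bmeasM.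
by under eq_fun do rewrite ImMc; apply: bmeasD; exact: bmeasM.
Qed.

Lemma cbmeas_cst (c : R[i]) : cbmeas (fun=> c).
Proof. by split; exact: bmeas_cst. Qed.

Lemma cbmeas_trig S F : trig S F -> cbmeas F.
Proof.
elim => [k _||F1 F2 _ ? _ ?|c F1 _ ?].
- exact: cbmeas_chr.
- exact: cbmeas_cst.
- exact: cbmeasD.
- by apply: cbmeasM => //; exact: cbmeas_cst.
Qed.

Definition cmean F : R[i] :=
  mean (fun p => complex.Re (F p)) +i* mean (fun p => complex.Im (F p)).

Lemma cmeanD F G : cbmeas F -> cbmeas G ->
  cmean (fun p => F p + G p) = cmean F + cmean G.
Proof.
move=> [? ?] [? ?]; rewrite /cmean.
under eq_fun do rewrite ReDc; rewrite meanD//.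
rewrite (_ : (fun p => complex.Im (F p + G p)) = fun p => complex.Im (F p) + complex.Im (G p)).
  by rewrite meanD.
by apply/funext => p; rewrite ImDc.
Qed.

Lemma cmeanZ (c : R[i]) F : cbmeas F -> cmean (fun p => c * F p) = c * cmean F.
Proof.
move=> [bR bI]; rewrite /cmean.
have bM (x : R) u : bmeas u -> bmeas (fun p => x * u p).
  by move=> ?; apply: bmeasM => //; exact: bmeas_cst.
under eq_fun do rewrite ReMc; rewrite meanB ?meanZ//; try exact: bM.
rewrite (_ : (fun p => complex.Im (c * F p)) = fun p => complex.Re c * complex.Im (F p) +
  complex.Im c * complex.Re (F p)); last by apply/funext => p; rewrite ImMc.
rewrite meanD ?meanZ//; try exact: bM.
by case: c.
Qed.

Lemma cmean_cst (c : R[i]) : cmean (fun=> c) = c.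
Proof. by rewrite /cmean !mean_cst; case: c. Qed.

Lemma cmean_chr k : cmean (chr k) = (k == 0)%:R.
Proof.
have [->|k0] := eqVneq.
  by rewrite (_ : chr 0 = fun=> 1) ?cmean_cst//; apply/funext => p; rewrite chr0.
rewrite /cmean /character/=.
rewrite (_ : (fun p => cos _) = fun p => cos (0 + (k.1%:~R * p.1 + k.2%:~R * p.2))); last first.
  by apply/funext => p; rewrite add0r.
rewrite (_ : (fun p => sin _) = fun p => cos (- (pi / 2) + (k.1%:~R * p.1 + k.2%:~R * p.2))).
  by rewrite !mean_cos.
by apply/funext => p; rewrite -sin_cosB.
Qed.

(** A nonconstant character has mean zero; the orthogonality and independence statements below rest
    on this. *)
Lemma cmean_trig0 S F : ~ S 0 -> trig S F -> cmean F = 0.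
Proof.
move=> S0; elim => [k Sk||F1 F2 t1 e1 t2 e2|c F1 t1 e1].
- by rewrite cmean_chr; case: eqP => // k0; case: S0; rewrite -k0.
- by rewrite cmean_cst.
- by rewrite cmeanD ?e1 ?e2 ?addr0//; [exact: cbmeas_trig t1|exact: cbmeas_trig t2].
- by rewrite cmeanZ ?e1 ?mulr0//; exact: cbmeas_trig t1.
Qed.

Lemma fourier_coefE F k : fourier_coef F k = cmean (fun p => F p * chr (- k) p).
Proof.
rewrite /fourier_coef /cmean /mean /torus_integral; case: k => a b/=.
by apply/eqP; rewrite eq_complex/= !mul0r subr0 addr0 !eqxx.
Qed.

Lemma fourier_coef_chr k l : fourier_coef (chr k) l = (k == l)%:R.
Proof.
rewrite fourier_coefE; under eq_fun do rewrite -chrD.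
by rewrite cmean_chr subr_eq0.
Qed.

Lemma fourier_coefD F G k : cbmeas F -> cbmeas G ->
  fourier_coef (fun p => F p + G p) k = fourier_coef F k + fourier_coef G k.
Proof.
move=> bF bG; rewrite !fourier_coefE -cmeanD.
- by congr cmean; apply/funext => p; rewrite mulrDl.
- by apply: cbmeasM => //; exact: cbmeas_chr.
- by apply: cbmeasM => //; exact: cbmeas_chr.
Qed.

Lemma fourier_coefZ c F k : cbmeas F ->
  fourier_coef (fun p => c * F p) k = c * fourier_coef F k.
Proof.
move=> bF; rewrite !fourier_coefE -cmeanZ.
  by congr cmean; apply/funext => p; rewrite mulrA.
by apply: cbmeasM => //; exact: cbmeas_chr.
Qed.

(** * Partial sums over a region with finitely many lattice points *)

Definition lattice (D : set (R * R)) : set (int * int) :=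
  [set k | D (k.1%:~R, k.2%:~R)].

Section PartialSum.
Variable D : set (R * R).
Hypothesis finD : finite_set (lattice D).

(** Finiteness matters here: a finitely supported sum takes the default value 0 on an infinite
    support. *)
Lemma partial_sumD F G p : cbmeas F -> cbmeas G ->
  partial_sum D p (fun p => F p + G p) = partial_sum D p F + partial_sum D p G.
Proof.
move=> bF bG; rewrite /partial_sum -fsbig_split//.
by apply: eq_fsbigr => k _; rewrite fourier_coefD// mulrDl.
Qed.

Lemma partial_sumZ c F p : cbmeas F ->
  partial_sum D p (fun p => c * F p) = c * partial_sum D p F.
Proof.
move=> bF; rewrite /partial_sum !(fsbig_finite _ _ finD) mulr_sumr.
by apply: eq_bigr => k _; rewrite fourier_coefZ// mulrA.
Qed.

Lemma partial_sum0 p : partial_sum D p (fun=> 0) = 0.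
Proof.
rewrite -[RHS](mul0r (partial_sum D p (fun=> 0))) -partial_sumZ; last exact: cbmeas_cst.
by congr partial_sum; apply/funext => q; rewrite mul0r.
Qed.

Lemma partial_sum_chr_in k p : lattice D k -> partial_sum D p (chr k) = chr k p.
Proof.
move=> Dk; rewrite /partial_sum (fsbigD1 k)//= fsbig1 => [|l [_ lk]].
  by rewrite addr0 fourier_coef_chr eqxx mul1r.
by rewrite fourier_coef_chr; case: eqP => [kl|_]; [case: lk|rewrite mul0r].
Qed.

Lemma partial_sum_chr_out k p : ~ lattice D k -> partial_sum D p (chr k) = 0.
Proof.
move=> Dk; rewrite /partial_sum fsbig1// => l Dl.
by rewrite fourier_coef_chr; case: eqP => [kl|_]; [case: Dk; rewrite kl|rewrite mul0r].
Qed.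

Lemma partial_sum_in S F p : S `<=` lattice D -> trig S F -> partial_sum D p F = F p.
Proof.
move=> SD; elim => [k Sk||F1 F2 t1 e1 t2 e2|c F1 t1 e1].
- by rewrite partial_sum_chr_in//; exact: SD.
- exact: partial_sum0.
- by rewrite partial_sumD ?e1 ?e2//; [exact: cbmeas_trig t1|exact: cbmeas_trig t2].
- by rewrite partial_sumZ ?e1//; exact: cbmeas_trig t1.
Qed.

Lemma partial_sum_out S F p : S `<=` ~` lattice D -> trig S F -> partial_sum D p F = 0.
Proof.
move=> SD; elim => [k Sk||F1 F2 t1 e1 t2 e2|c F1 t1 e1].
- by rewrite partial_sum_chr_out//; exact: SD.
- exact: partial_sum0.
- by rewrite partial_sumD ?e1 ?e2 ?addr0//; [exact: cbmeas_trig t1|exact: cbmeas_trig t2].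
- by rewrite partial_sumZ ?e1 ?mulr0//; exact: cbmeas_trig t1.
Qed.

End PartialSum.

Lemma finite_lattice_Delta (a b : R) : 0 < a -> 0 < b -> finite_set (lattice (Delta a b)).
Proof.
(* Both intercepts [1/a] and [1/b] are below [m], so adding [m] to a coordinate lands in
   [[0, 2m)]. *)
move=> a0 b0; set m := (Num.truncn (a^-1 + b^-1)).+1.
pose g (ij : nat * nat) := (ij.1%:Z - m%:Z, ij.2%:Z - m%:Z).
apply: (@sub_finite_set _ _ (g @` (`I_(2 * m) `*` `I_(2 * m)))).
  move=> [x y] /= D1.
  have /andP[xm ym] : (`|x| < m%:Z) && (`|y| < m%:Z).
    have mE : a^-1 + b^-1 < m%:R by rewrite /m truncnS_gt.
    have aV : 0 < a^-1 by rewrite invr_gt0.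
    have bV : 0 < b^-1 by rewrite invr_gt0.
    have bound (c d z w : R) : 0 < c -> 0 < d -> c * `|z| + d * `|w| <= 1 -> `|z| <= c^-1.
      move=> c0 d0 h; rewrite -(ler_pM2l c0) mulfV ?gt_eqF// (le_trans _ h)// lerDl.
      by rewrite mulr_ge0// ltW.
    have Dx : `|x%:~R| <= a^-1 :> R by exact: (bound _ _ _ _ a0 b0 D1).
    have Dy : `|y%:~R| <= b^-1 :> R by apply: (bound _ _ _ x%:~R b0 a0); rewrite addrC.
    rewrite -(ltr_int R) -[in X in _ && X](ltr_int R) !intr_norm -!pmulrn; lra.
  exists (absz (x + m%:Z)%R, absz (y + m%:Z)%R).
    by split => /=; lia.
  by rewrite /g /=; congr pair; lia.
by apply: finite_image; apply: finite_setX; exact: finite_II.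
Qed.

End Trig.

(** * Low and high frequencies, and substitution of characters into polynomials *)

Section Spectrum.
Context {R : realType}.
Implicit Types (S T : set (int * int)) (F G : R * R -> R[i]) (p : R * R).
Implicit Types (k l K : int * int) (d e q : nat).

Local Notation chr := (@character R).
Local Notation nrm := (@Normc.normc R).

Definition box d : set (int * int) := [set k | (absz k.1 <= d)%N /\ (absz k.2 <= d)%N].
(** The first coordinate is enough to separate the levels of the tree: for the nodes of depth [l] it
    is at least [scale l] in absolute value. *)
Definition high e : set (int * int) := [set k | (e <= absz k.1)%N].

Lemma box_le d e : (d <= e)%N -> box d `<=` box e.
Proof. by move=> de k [k1 k2]; split; apply: leq_trans de. Qed.

Lemma high_le d e : (e <= d)%N -> high d `<=` high e.
Proof. by move=> de k; apply: leq_trans. Qed.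

Lemma boxS d e F : (d <= e)%N -> trig (box d) F -> trig (box e) F.
Proof. by move=> de; apply: trigS; exact: box_le. Qed.

Lemma highS d e F : (e <= d)%N -> trig (high d) F -> trig (high e) F.
Proof. by move=> de; apply: trigS; exact: high_le. Qed.

Lemma boxM d e F G : trig (box d) F -> trig (box e) G ->
  trig (box (d + e)) (fun p => F p * G p).
Proof.
move=> tF tG; apply: (trigM tF tG) => -[a b] [a' b'] [/= ? ?] [/= ? ?].
by split => /=; lia.
Qed.

Lemma highM d e F G : trig (box d) F -> trig (high e) G ->
  trig (high (e - d)) (fun p => F p * G p).
Proof.
move=> tF tG; apply: (trigM tF tG) => -[a b] [a' b'] [/= ? ?].
by rewrite /high/=; lia.
Qed.

Lemma boxJ d F : trig (box d) F -> trig (box d) (fun p => (F p)^*).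
Proof.
by move=> /trigJ; apply: trigS => -[a b] [/= ? ?]; split => /=; lia.
Qed.

Lemma box_cst d (c : R[i]) : trig (box d) (fun=> c).
Proof. by apply: trig_cst; split. Qed.

Lemma box_nrm2 d F : trig (box d) F -> trig (box (d + d)) (fun p => (nrm (F p) ^+ 2)%:C).
Proof.
move=> tF; apply: (eq_trig (F := fun p => F p * (F p)^*)) => [p|].
  exact: mulcJ.
by apply: boxM => //; exact: boxJ.
Qed.

Lemma cmean_high e F : (0 < e)%N -> trig (high e) F -> cmean F = 0.
Proof. by move=> e0; apply: cmean_trig0; rewrite /high/= leqn0 gtn_eqF. Qed.

Lemma bmeas_nrm2 F : cbmeas F -> bmeas (fun p => nrm (F p) ^+ 2).
Proof.
move=> [bR bI]; under eq_fun do rewrite sqr_nrm !expr2.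
by apply: bmeasD; exact: bmeasM.
Qed.

Lemma sqr_nrmD (z w : R[i]) :
  nrm (z + w) ^+ 2 = nrm z ^+ 2 + nrm w ^+ 2 + 2 * complex.Re (z^* * w).
Proof. by rewrite !sqr_nrm; case: z w => [a b] [c d] /=; ring. Qed.

(** Pythagoras: in the cross term all first frequencies are at least [e - d > 0] in absolute value,
    so its mean vanishes. *)
Lemma mean_nrm2D d e F G : (d < e)%N -> trig (box d) F -> trig (high e) G ->
  mean (fun p => nrm (F p + G p) ^+ 2) =
  mean (fun p => nrm (F p) ^+ 2) + mean (fun p => nrm (G p) ^+ 2).
Proof.
move=> de tF tG; have tFG := highM (boxJ tF) tG.
have bF := bmeas_nrm2 (cbmeas_trig tF); have bG := bmeas_nrm2 (cbmeas_trig tG).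
have [bFG _] := cbmeas_trig tFG.
rewrite (_ : (fun p => _) = fun p => (nrm (F p) ^+ 2 + nrm (G p) ^+ 2) +
  2 * complex.Re ((F p)^* * G p)); last by apply/funext => p; rewrite sqr_nrmD.
rewrite meanD; [|exact: bmeasD|by apply: bmeasM => //; exact: bmeas_cst].
rewrite meanD// meanZ//.
have : cmean (fun p => (F p)^* * G p) = 0 by apply: cmean_high tFG; rewrite subn_gt0.
by move=> [-> _]; rewrite mulr0 addr0.
Qed.

Let e1 : int * int := (1, 0).
(** Evaluation at this point turns a polynomial in [chr e1] into the same polynomial in [chr K]. *)
Let phase K p : R * R := (K.1%:~R * p.1 + K.2%:~R * p.2, 0).

Lemma chr_phase k K p : chr k (phase K p) = chr (k.1 * K.1, k.1 * K.2) p.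
Proof.
rewrite /character /phase/= mulr0 addr0 !intrM mulrDr !mulrA//.
Qed.

Lemma trig_phase S T K F : trig S F -> (forall k, S k -> T (k.1 * K.1, k.1 * K.2)) ->
  trig T (fun p => F (phase K p)).
Proof.
move=> tF ST; elim: tF => [k Sk||F1 F2 _ ? _ ?|c F1 _ ?].
- under eq_fun do rewrite chr_phase.
  by constructor; exact: ST.
- exact: trig0.
- exact: trigD.
- exact: trigZ.
Qed.

(** On the axis [y = 0] the characters with vanishing first frequency are constant; they are
    gathered in [a]. *)
Lemma trig_split q F : trig (box q) F ->
  exists a F', trig [set k | k.1 != 0] F' /\ forall x, F (x, 0) = a + F' (x, 0).
Proof.
elim => [k Sk||F1 F2 _ [a1 [G1 [t1 E1]]] _ [a2 [G2 [t2 E2]]]|c F1 _ [a [G [t E]]]].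
- have [k0|k0] := eqVneq k.1 0.
    exists 1, (fun=> 0); split; first exact: trig0.
    by move=> x; rewrite addr0 /character/= k0 mul0r mulr0 addr0 expi0.
  by exists 0, (chr k); split => [|x]; [constructor|rewrite add0r].
- by exists 0, (fun=> 0); split; [exact: trig0|move=> x; rewrite addr0].
- exists (a1 + a2), (fun p => G1 p + G2 p); split; first exact: trigD.
  by move=> x; rewrite E1 E2 addrACA.
- exists (c * a), (fun p => c * G p); split; first exact: trigZ.
  by move=> x; rewrite E mulrDr.
Qed.

Lemma chr_e1_phase K p : chr e1 (phase K p) = chr K p.
Proof. by rewrite chr_phase/= !mul1r -surjective_pairing. Qed.

(** Once the mean is removed, only nonzero multiples of [K] remain as frequencies. This makes a
    function of [chr K] uncorrelated with functions of low degree. *)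
Lemma high_along q (H : R[i] -> R[i]) K : trig (box q) (fun p => H (chr e1 p)) ->
  trig (high (absz K.1)) (fun p => H (chr K p) - cmean (fun p => H (chr e1 p))).
Proof.
move=> tH; have [a [G [tG E]]] := trig_split tH.
have EG K' p : H (chr K' p) = a + G (phase K' p) by rewrite -E -chr_e1_phase.
have tp K' : trig (high (absz K'.1)) (fun p => G (phase K' p)).
  apply: (trig_phase tG) => -[k1 k2]; rewrite /high /= abszM => k0.
  by apply: leq_pmull; rewrite absz_gt0.
have -> : cmean (fun p => H (chr e1 p)) = a.
  under eq_fun do rewrite EG.
  by rewrite cmeanD ?cmean_cst ?(cmean_high _ (tp e1)) ?addr0//;
    [exact: cbmeas_cst|exact: cbmeas_trig (tp e1)].
by apply: eq_trig (tp K) => p; rewrite EG addrC addKr.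
Qed.

Lemma box_along q (H : R[i] -> R[i]) d K : trig (box q) (fun p => H (chr e1 p)) ->
  box d K -> trig (box (q * d)) (fun p => H (chr K p)).
Proof.
move=> tH [K1 K2]; apply: (eq_trig (F := fun p => H (chr e1 (phase K p)))) => [p|].
  by rewrite chr_e1_phase.
apply: (trig_phase tH) => -[a b] [/= ? ?].
by split; rewrite /= abszM leq_mul.
Qed.

(** Both sides have the same constant term, as multiplication by [K.1] keeps nonzero first
    frequencies nonzero. *)
Lemma cmean_along q (H : R[i] -> R[i]) K : trig (box q) (fun p => H (chr e1 p)) ->
  K.1 != 0 -> cmean (fun p => H (chr K p)) = cmean (fun p => H (chr e1 p)).
Proof.
move=> tH K0; have tK := high_along K tH.
rewrite (_ : (fun p => H (chr K p)) = fun p => (H (chr K p) - cmean (fun p => H (chr e1 p)))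
   + cmean (fun p => H (chr e1 p))); last by apply/funext => p; rewrite subrK.
rewrite cmeanD; [|exact: cbmeas_trig tK|exact: cbmeas_cst].
by rewrite cmean_cst (cmean_high _ tK) ?add0r// absz_gt0.
Qed.

(** A geometric sum in [- z ^+ 2] for [z = chr e1 p]. It peaks where [z ^+ 2 = -1], that is where
    [Re z = 0], and its squared modulus is [m] times a Fejer kernel. *)
Let w m p : R[i] := \sum_(j < m) (- chr e1 p ^+ 2) ^+ j.

Lemma chr_e1X n p : chr e1 p ^+ n = chr (n%:Z, 0) p.
Proof.
elim: n => [|n IH]; first by rewrite expr0 chr0.
by rewrite exprS IH -chrD; congr chr; rewrite /e1 intS.
Qed.

Lemma fejer_box m : trig (box (2 * m)) (w m).
Proof.
rewrite /w; apply: trig_sum => j _.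
under eq_fun do rewrite exprNn -exprM chr_e1X.
by apply: trigZ; constructor; have := ltn_ord j; split => /=; lia.
Qed.

Lemma mean_fejer m : mean (fun p => nrm (w m p) ^+ 2) = m%:R.
Proof.
elim: m => [|m IH].
  rewrite -[RHS](mean_cst); congr mean; apply/funext => p.
  by rewrite /w big_ord0 Normc.normc0 expr0n.
under eq_fun do rewrite /w big_ord_recr/=.
(* A single term is treated apart; from then on the frequency of the new term exceeds the degree of
   the previous sum. *)
case: m IH => [_|m IH].
  rewrite -[RHS](mean_cst); congr mean; apply/funext => p.
  by rewrite big_ord0 add0r expr0 Normc.normc1 expr1n.
have tw : trig (box (2 * m)) (w m.+1).
  rewrite /w; apply: trig_sum => j _.
  under eq_fun do rewrite exprNn -exprM chr_e1X.
  by apply: trigZ; constructor; have := ltn_ord j; split => /=; lia.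
have th : trig (high (2 * m.+1)) (fun p => (- chr e1 p ^+ 2) ^+ m.+1).
  under eq_fun do rewrite exprNn -exprM chr_e1X.
  by apply: trigZ; constructor; rewrite /high/=; lia.
rewrite (mean_nrm2D _ tw th); last by lia.
rewrite IH -(natr1 m.+1); congr (_ + _).
rewrite -[RHS](mean_cst); congr mean; apply/funext => p.
by rewrite exprNn -exprM chr_e1X Normc.normcM nrm_chr mulr1 -signr_odd; case: odd;
  rewrite ?expr1 ?expr0 ?normcN Normc.normc1 expr1n.
Qed.

Lemma nrm_sub1X (z : R[i]) n : nrm z = 1 -> nrm (1 - z ^+ n) <= n%:R * nrm (1 - z).
Proof.
move=> z1; elim: n => [|n IH]; first by rewrite expr0 subrr Normc.normc0 mul0r.
have -> : 1 - z ^+ n.+1 = (1 - z ^+ n) + z ^+ n * (1 - z) by rewrite exprSr; ring.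
rewrite (le_trans (le_normcD _ _))// -natr1 mulrDl mul1r lerD// Normc.normcM.
have -> : nrm (z ^+ n) = 1.
  elim: (n) => [|k IHk]; first by rewrite expr0 Normc.normc1.
  by rewrite exprS Normc.normcM z1 IHk mulr1.
by rewrite mul1r.
Qed.

(** On the unit circle [1 + z ^+ 2 = z * (z^* + z)]. *)
Lemma nrm_1Dsqr (z : R[i]) : nrm z = 1 -> nrm (1 + z ^+ 2) = 2 * `|complex.Re z|.
Proof.
move=> z1; have -> : 1 + z ^+ 2 = z * (2 * complex.Re z)%:C.
  have : z * z^* = 1 by rewrite mulcJ z1 expr1n.
  move=> <-; case: (z) => a b; apply/eqP; rewrite eq_complex/=.
  by apply/andP; split; apply/eqP; ring.
by rewrite Normc.normcM z1 mul1r nrm_real normrM ger0_norm.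
Qed.

(* The Fejer kernel concentrated at the zeros of the cosine. *)
Lemma fejer (delta : R) : 0 < delta -> exists (Psi : R[i] -> R) (eta : R) q,
  [/\ 0 < eta, forall z, 0 <= Psi z,
      trig (box q) (fun p => (Psi (chr e1 p))%:C),
      mean (fun p => Psi (chr e1 p)) <= delta &
      forall z, nrm z = 1 -> `|complex.Re z| <= eta -> 1 <= Psi z].
Proof.
move=> d0; pose m := (Num.truncn (4 / delta)).+1.
have m0 : 0 < m%:R :> R by rewrite ltr0n.
have md : 4 / delta < m%:R by rewrite truncnS_gt.
pose W (z : R[i]) := \sum_(j < m) (- z ^+ 2) ^+ j.
(* The mean of this function is [4 / m], at most [delta]. The width [1 / (4m)] keeps each power of
   [- z ^+ 2] in the sum within 1/2 of 1, so that [W z] has modulus at least [m / 2]. *)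
exists (fun z => 4 / m%:R ^+ 2 * nrm (W z) ^+ 2), (4 * m%:R)^-1, (2 * m + 2 * m)%N.
have tW := box_nrm2 (fejer_box m).
have bW := bmeas_nrm2 (cbmeas_trig (fejer_box m)).
split.
- by rewrite invr_gt0 mulr_gt0.
- by move=> z; rewrite mulr_ge0 ?sqr_ge0// divr_ge0// sqr_ge0.
- by under eq_fun do rewrite rmorphM; exact: trigZ.
- rewrite meanZ// mean_fejer expr2 invfM mulrA mulfVK ?gt_eqF//.
  by rewrite ler_pdivrMr// mulrC -ler_pdivrMr// ltW.
- move=> z z1 zeta.
  have zz1 : nrm (- z ^+ 2) = 1 by rewrite normcN expr2 Normc.normcM z1 mulr1.
  have h1 : nrm (1 - - z ^+ 2) <= (2 * m%:R)^-1.
    rewrite opprK nrm_1Dsqr// (le_trans (ler_wpM2l _ zeta))//.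
    by rewrite le_eqVlt; apply/orP; left; apply/eqP; field; rewrite gt_eqF.
  have h2 : nrm (m%:R - W z) <= m%:R / 2.
    have -> : m%:R - W z = \sum_(j < m) (1 - (- z ^+ 2) ^+ j).
      by rewrite sumrB sumr_const card_ord.
    rewrite (le_trans (nrm_sum _ _ _))//.
    apply: (le_trans (y := \sum_(j < m) 2^-1)); last first.
      by rewrite sumr_const card_ord -[leLHS]mulr_natl.
    apply: ler_sum => j _; rewrite (le_trans (nrm_sub1X _ zz1))//.
    apply: (le_trans (y := m%:R * (2 * m%:R)^-1)); last first.
      by rewrite le_eqVlt; apply/orP; left; apply/eqP; field; rewrite gt_eqF.
    by rewrite ler_pM ?nrm_ge0// ler_nat ltnW.
  have h3 : m%:R / 2 <= nrm (W z).
    have : nrm (m%:R : R[i]) <= nrm (m%:R - W z) + nrm (W z).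
      by rewrite -{1}(subrK (W z) m%:R) le_normcD.
    have -> : nrm (m%:R : R[i]) = m%:R by rewrite -(rmorph_nat (real_complex R)) nrm_real ger0_norm.
    by move: h2; lra.
  rewrite -ler_pdivrMl ?divr_gt0 ?exprn_gt0// mulr1 invf_div.
  apply: (le_trans (y := (m%:R / 2) ^+ 2)); last first.
    by rewrite ler_sqr ?nnegrE ?nrm_ge0// divr_ge0// ltW.
  by rewrite expr_div_n ler_pM2l ?exprn_gt0// lef_pV2 ?posrE ?exprn_gt0//; lra.
Qed.

End Spectrum.

(** * A polynomial switch between 0 and 1 *)

Section Sharp.
Context {R : realType}.
Implicit Types (p : R * R) (c t : R) (k q : nat).

Local Notation chr := (@character R).
Local Notation nrm := (@Normc.normc R).
Let e1 : int * int := (1, 0).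
Let x p : R := complex.Re (chr e1 p).

Definition sharpen t : R := (3 * t - t ^+ 3) / 2.

Lemma sharpen_bound k c : -1 <= c <= 1 -> -1 <= iter k sharpen c <= 1.
Proof.
move=> c1; elim: k => //= k; set t := iter k sharpen c => /andP[t1 t2].
have E1 : 1 - sharpen t = (1 - t) ^+ 2 * (2 + t) / 2 by rewrite /sharpen; field.
have E2 : sharpen t + 1 = (1 + t) ^+ 2 * (2 - t) / 2 by rewrite /sharpen; field.
apply/andP; split.
  by rewrite -subr_ge0 opprK E2 divr_ge0// mulr_ge0 ?sqr_ge0//; lra.
by rewrite -subr_ge0 E1 divr_ge0// mulr_ge0 ?sqr_ge0//; lra.
Qed.

(** Each iteration keeps the sign and does not approach 0, since
    [sharpen t - t = t (1 - t^2) / 2]. *)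
Lemma sharpen_ge k c : -1 <= c <= 1 -> c ^+ 2 <= c * iter k sharpen c.
Proof.
move=> c1; elim: k => [|k IH] //=; have := sharpen_bound k c1.
move: IH; set t := iter k sharpen c => IH /andP[t1 t2].
have ct : 0 <= c * t by rewrite (le_trans _ IH)// sqr_ge0.
rewrite (le_trans IH)// -subr_ge0.
have -> : c * sharpen t - c * t = c * t * ((1 - t) * (1 + t)) / 2 by rewrite /sharpen; field.
by rewrite divr_ge0// mulr_ge0// mulr_ge0//; lra.
Qed.

(** At each iteration the defect [1 - t^2] drops below its square: [1 - sharpen t ^+ 2] equals
    [(1 - t^2)^2 (1 - t^2 / 4)]. *)
Lemma sharpen_le k c : -1 <= c <= 1 ->
  1 - iter k sharpen c ^+ 2 <= (1 - c ^+ 2) ^+ (2 ^ k).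
Proof.
move=> c1; elim: k => [|k IH]; first by rewrite expn0 expr1.
have := sharpen_bound k c1; move: IH => /=; set t := iter k sharpen c => IH /andP[t1 t2].
have u0 : 0 <= 1 - t ^+ 2.
  by rewrite (_ : _ - _ = (1 - t) * (1 + t)); [rewrite mulr_ge0//; lra|ring].
apply: (le_trans (y := (1 - t ^+ 2) ^+ 2)).
  rewrite -subr_ge0 (_ : _ - _ = (1 - t ^+ 2) ^+ 2 * t ^+ 2 / 4).
    by rewrite divr_ge0// mulr_ge0// sqr_ge0.
  by rewrite /sharpen; field.
by rewrite expnS mulnC exprM ler_sqr ?nnegrE// (le_trans u0).
Qed.

Lemma box_sharpen k : trig (box (3 ^ k)) (fun p => (iter k sharpen (x p))%:C).
Proof.
elim: k => [|k IH] /=.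
  apply: (eq_trig (F := fun p => 2^-1 * (chr e1 p + (chr e1 p)^* ))) => [p|].
    by rewrite addcJ mulrA mulVf ?mul1r// pnatr_eq0.
  have te : trig (box 1) (chr e1) by constructor; split.
  by apply: trigZ; apply: trigD => //; exact: boxJ te.
set F := fun p => (iter k sharpen (x p))%:C in IH.
apply: (eq_trig (F := fun p => 2^-1 * (3 * F p + - (F p * F p * F p)))) => [p|].
  rewrite /F /sharpen -!rmorphM/= -rmorphN/= -(rmorph_nat (real_complex R) 3).
  rewrite -rmorphM/= -rmorphD/= -(rmorph_nat (real_complex R) 2) -fmorphV -rmorphM/=.
  by congr (_%:C); rewrite mulrC !exprS expr0 mulr1 !mulrA.
apply: trigZ; apply: trigD.
  by apply: trigZ; apply: boxS IH; rewrite leq_exp2l.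
apply: trigN; rewrite expnS (_ : 3 * 3 ^ k = 3 ^ k + 3 ^ k + 3 ^ k)%N; last by lia.
by apply: boxM => //; exact: boxM.
Qed.

Lemma Re_chr_bound (k : int * int) p : -1 <= complex.Re (chr k p) <= 1.
Proof. by rewrite -ler_norml (le_trans (ler_Re_nrm _))// nrm_chr. Qed.

Lemma expr_lt_eventually (r delta : R) : 0 <= r < 1 -> 0 < delta -> exists k, r ^+ k <= delta.
Proof.
move=> /andP[r0 r1] d0.
have /cvgrPdist_le/(_ _ d0)[k _ /(_ k (leqnn _))] : r ^+ n @[n --> \oo] --> (0 : R).
  by apply: cvg_expr; rewrite ger0_norm.
by rewrite sub0r normrN ger0_norm ?exprn_ge0//; exists k.
Qed.

(* A polynomial phi close to the indicator of [0, 1] on [-1, 1]; 2 phi - 1 is an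
   iterate of the odd map t |-> (3t - t^3)/2, which pushes [-1, 1] to {-1, 1}. *)
Lemma sharp_switch (delta : R) : 0 < delta -> exists (phi : R -> R) (kappa : R) q,
  [/\ forall c, -1 <= c <= 1 -> 0 <= phi c <= 1,
      trig (box q) (fun p => (phi (x p))%:C),
      cmean (fun p => chr e1 p * (phi (x p))%:C) = kappa%:C,
      4^-1 <= kappa &
      mean (fun p => phi (x p) * (1 - phi (x p))) <= delta].
Proof.
move=> d0; have [|Psi [eta [q [eta0 Psi0 tPsi mPsi Psi1]]]] := @fejer R delta.
  by [].
(* Where [|x| > eta], the quantity [1 - x^2] is at most [r]; the minimum with 1 keeps [r]
   nonnegative. *)
pose r := 1 - Num.min eta 1 ^+ 2.
have r01 : 0 <= r < 1.
  have m0 : 0 < Num.min eta 1 by rewrite lt_min eta0 ltr01.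
  have m1 : Num.min eta 1 <= 1 by rewrite ge_min lexx orbT.
  rewrite /r subr_ge0 gtrBl exprn_gt0// andbT -[leRHS](expr1n _ 2).
  by rewrite ler_sqr ?nnegrE// ltW.
have [k rk] := expr_lt_eventually r01 d0.
pose v c := iter k sharpen c.
have tv := box_sharpen k.
have bv : bmeas (fun p => v (x p)) by have [] := cbmeas_trig tv.
have bx : bmeas x by have [] := cbmeas_chr (R := R) e1.
pose phi c := (1 + v c) / 2.
have tphi : trig (box (3 ^ k)) (fun p => (phi (x p))%:C).
  apply: (eq_trig (F := fun p => 2^-1 * (1 + (v (x p))%:C))) => [p|].
    rewrite -(rmorph_nat (real_complex R) 2) -fmorphV -(rmorph1 (real_complex R)).
    by rewrite -rmorphD -rmorphM/= mulrC.
  by apply: trigZ; apply: trigD; [exact: box_cst|].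
pose H (z : R[i]) := z * (phi (complex.Re z))%:C.
have tH : trig (box (1 + 3 ^ k)) (fun p => H (chr e1 p)).
  by apply: boxM => //; constructor; split.
have bH := cbmeas_trig tH.
exists phi, (complex.Re (cmean (fun p => H (chr e1 p)))), (3 ^ k)%N; split => //.
- by move=> c c1; have := sharpen_bound k c1; rewrite /phi /v => /andP[? ?]; lra.
(* Replacing [e1] by [- e1] conjugates the integrand and preserves its mean, which is therefore
   real. *)
- have : cmean (fun p => H (chr (-1, 0) p)) = cmean (fun p => H (chr e1 p)).
    exact: cmean_along tH _.
  move=> /(congr1 (@complex.Im R)); rewrite /cmean [LHS]/= [RHS]/=.
  have -> : (fun p => complex.Im (H (chr (-1, 0) p))) = (fun p => - complex.Im (H (chr e1 p))).
    apply/funext => p; rewrite (_ : (-1, 0) = - e1)// chrN /H.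
    by case: (chr e1 p) => a b /=; ring.
  rewrite meanN; last by case: bH.
  move=> h; apply/eqP; rewrite eq_complex eqxx andTb; apply/eqP.
  by rewrite -/(cmean (fun p => H (chr e1 p))) [LHS]/= [RHS]/=; lra.
(* As [x v(x) >= x^2], the mean of [x phi(x) = x / 2 + x v(x) / 2] is at least half the mean of
   [x^2], which is 1/2. *)
- rewrite /cmean/=.
  have sq p : x p ^+ 2 = 2^-1 * (1 + complex.Re (chr (2, 0) p)).
    have -> : chr (2, 0) p = chr e1 p * chr e1 p by rewrite -chrD.
    have := sqr_nrm (chr e1 p); rewrite nrm_chr expr1n ReMc /x !expr2 => h.
    by move: h; lra.
  have bsq : bmeas (fun p => x p ^+ 2) by under eq_fun do rewrite expr2; exact: bmeasM.
  have msq : mean (fun p => x p ^+ 2) = 2^-1.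
    under eq_fun do rewrite sq.
    have [b2 _] := cbmeas_chr (R := R) (2, 0).
    rewrite meanZ; last by apply: bmeasD => //; exact: bmeas_cst.
    rewrite meanD//; last exact: bmeas_cst.
    rewrite mean_cst; have := @cmean_chr R (2, 0); rewrite /cmean => -[-> _].
    by rewrite addr0 mulr1.
  have mx : mean x = 0 by have := @cmean_chr R e1; rewrite /cmean => -[-> _].
  have E : (fun p => complex.Re (H (chr e1 p))) = (fun p => 2^-1 * x p + 2^-1 * (x p * v (x p))).
    apply/funext => p; rewrite /H ReMc.
    rewrite -[LHS]/(x p * phi (x p) - complex.Im (chr e1 p) * 0) mulr0 subr0 /phi.
    by move: (x p) (v (x p)) => a b; field.
  have bxv : bmeas (fun p => x p * v (x p)) by exact: bmeasM.
  rewrite E meanD ?meanZ//; try by apply: bmeasM => //; exact: bmeas_cst.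
  rewrite mx mulr0 add0r; have : mean (fun p => x p ^+ 2) <= mean (fun p => x p * v (x p)).
    by apply: ler_mean => // p; exact: sharpen_ge (Re_chr_bound e1 p).
  by rewrite msq; lra.
- have [bP _] := cbmeas_trig tPsi.
  (* Here [phi (1 - phi) = (1 - v^2) / 4]. For [|x| <= eta] the kernel [Psi] dominates [1 - v^2];
     elsewhere [1 - v^2 <= r ^+ (2 ^ k) <= delta]. *)
  apply: (le_trans (y := mean (fun p => 4^-1 * (delta + Psi (chr e1 p))))).
    apply: ler_mean => [||p].
    + apply: bmeasM; rewrite /phi; last apply: bmeasB; first [exact: bmeas_cst|
        apply: bmeasM; [apply: bmeasD => //|]; exact: bmeas_cst].
    + by apply: bmeasM; [exact: bmeas_cst|apply: bmeasD => //; exact: bmeas_cst].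
    + have -> : phi (x p) * (1 - phi (x p)) = 4^-1 * (1 - v (x p) ^+ 2) by rewrite /phi; field.
      rewrite ler_pM2l ?invr_gt0//.
      have [xe|xe] := leP `|x p| eta.
        have P1 := Psi1 _ (nrm_chr e1 p) xe.
        have : 0 <= v (x p) ^+ 2 by exact: sqr_ge0.
        by lra.
      rewrite (le_trans (sharpen_le k (Re_chr_bound e1 p)))//.
      have P0 := Psi0 (chr e1 p).
      suff : (1 - x p ^+ 2) ^+ (2 ^ k) <= delta by rewrite /x; lra.
      have /andP[x1 x2] := Re_chr_bound e1 p.
      have x0 : 0 <= 1 - x p ^+ 2.
        by rewrite (_ : _ - _ = (1 - x p) * (1 + x p)); [rewrite mulr_ge0// /x; lra|ring].
      have xr : 1 - x p ^+ 2 <= r.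
        rewrite lerD2l lerN2 -[leRHS]ger0_norm ?sqr_ge0// normrX ler_sqr ?nnegrE//.
          by rewrite ge_min (ltW xe).
        by rewrite le_min (ltW eta0) ler01.
      have /andP[r0 r1] := r01.
      rewrite (le_trans (lerXn2r _ _ _ xr))//.
      rewrite (le_trans _ rk)// ler_wiXn2l// ?(ltW r1)//.
      by rewrite ltnW// ltn_expl.
  rewrite meanZ; last by apply: bmeasD => //; exact: bmeas_cst.
  by rewrite meanD//; [rewrite mean_cst; lra|exact: bmeas_cst].
Qed.

End Sharp.

(** * The tree, the smoothed walk and its prefix sums *)

Section Block.
Context {R : realType}.
Variables (n D q : nat) (c kappa tau : R) (phi : R -> R).
Implicit Types (p : R * R) (l j k m w : nat).

Local Notation chr := (@character R).
Local Notation nrm := (@Normc.normc R).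
Local Notation e1 := ((1, 0) : int * int).

Hypothesis phi01 : forall t, -1 <= t <= 1 -> 0 <= phi t <= 1.
Hypothesis c01 : 0 < c <= 2^-1.
Hypothesis kappaE :
  cmean (fun p => chr e1 p * (phi (complex.Re (chr e1 p)))%:C) = kappa%:C.
Hypothesis tphi : trig (box q) (fun p => (phi (complex.Re (chr e1 p)))%:C).
Hypothesis kappa_ge : 4^-1 <= kappa.
Hypothesis tauE : mean (fun p => phi (complex.Re (chr e1 p)) *
  (1 - phi (complex.Re (chr e1 p)))) = tau.
Hypothesis nD : (2 ^ n <= D)%N.

(** Bounds the degree of [walk l] and of the weights of depth [l]. A step adds exponentials with
    coefficients of degree [3 * deg l]; passing to the children multiplies weights by a switch of
    degree [q] in such an exponential. *)
Fixpoint deg l : nat :=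
  if l is l'.+1 then (3 * deg l' + (q + 1) * (D * (20 * deg l' + 20)))%N else 0%N.

(** The factor 20 leaves room for the frequency shifts caused by low-degree coefficients, both in
    the orthogonality of the levels and in the separation by the rhombi. *)
Definition scale l : nat := (20 * deg l + 20)%N.

(* The in-order position, in 1, ..., 2^n - 1, of the j-th node of depth l of the
   binary tree of height n. *)
Definition rank l j : nat := (2 ^ (n - l.+1) * (2 * j + 1))%N.

(** The direction depends on the rank only, the size on [scale]. For nodes of the tree the truncated
    subtraction is exact, their ranks being less than [D]. *)
Definition freq l j : int * int :=
  (- ((D - rank l j) * scale l)%N%:Z, (D * scale l)%N%:Z).

Definition phase l j p : R := phi (complex.Re (chr (freq l j) p)).

(* At each level the weights are a partition of unity, a smooth version of the
   indicators of the events that the walk is at the given node. *)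
Fixpoint weight l j p : R :=
  if l is l'.+1 then weight l' j./2 p *
    (if odd j then phase l' j./2 p else 1 - phase l' j./2 p)
  else 1.

(** The current value [z] of the walk is an argument so that [walk] can be defined by structural
    recursion. *)
Definition node_of (z : R[i]) l j p : R[i] :=
  (c * (1 - nrm z ^+ 2) * weight l j p)%:C * chr (freq l j) p.

Fixpoint walk l p : R[i] :=
  if l is l'.+1 then walk l' p + \sum_(j < 2 ^ l') node_of (walk l' p) l' j p
  else 0.

Definition node l j p : R[i] := node_of (walk l p) l j p.

Definition tail l m p : R := \sum_(j < 2 ^ l | (m <= j)%N) weight l j p.

(** By [mass_rank], the total weight of the leaves to the right of the node. *)
Definition mass l j p : R := weight l.+1 (2 * j + 1) p + tail l j.+1 p.

(** As the weights sum to 1, this is close to 1 only when they nearly concentrate on one node, as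
    for a sharp walk. *)
Definition energy l p : R := \sum_(j < 2 ^ l) weight l j p ^+ 2.

(* What remains of \sum_j node l j * mass l j once its mean with respect to the
   exponentials of level l is removed; see sum_node_mass. *)
Definition noise l p : R[i] := (c * (1 - nrm (walk l p) ^+ 2))%:C *
  \sum_(j < 2 ^ l) (weight l j p)%:C *
    (chr (freq l j) p * (mass l j p)%:C - (kappa * weight l j p)%:C).

(** * Pointwise identities and bounds *)

Lemma phase01 l j p : 0 <= phase l j p <= 1.
Proof. by apply: phi01; exact: Re_chr_bound. Qed.

Lemma weight_ge0 l j p : 0 <= weight l j p.
Proof.
elim: l j => //= l IH j; rewrite mulr_ge0//.
by have /andP[? ?] := phase01 l j./2 p; case: ifP; rewrite ?subr_ge0.
Qed.

Lemma weight_even l j p : weight l.+1 (2 * j) p = weight l j p * (1 - phase l j p).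
Proof. by rewrite /= mul2n odd_double doubleK. Qed.

Lemma weight_odd l j p : weight l.+1 (2 * j + 1) p = weight l j p * phase l j p.
Proof.
by rewrite mul2n addn1 /= odd_double/= uphalf_double.
Qed.

Local Arguments weight : simpl never.

Lemma sum_double (V : nmodType) (P : pred nat) (g : nat -> V) m :
  \sum_(j < 2 * m | P j) g j =
  \sum_(j < m | P (2 * j)%N) g (2 * j)%N + \sum_(j < m | P (2 * j + 1)%N) g (2 * j + 1)%N.
Proof.
elim: m => [|m IH]; first by rewrite !big_ord0 addr0.
rewrite mulnS add2n big_mkcond/= !big_ord_recr/= -big_mkcond/= IH.
rewrite [X in _ = X + _]big_mkcond [X in _ = _ + X]big_mkcond/= !big_ord_recr/=.
by rewrite -!big_mkcond/= addn1 -!addrA; congr (_ + _); rewrite addrCA.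
Qed.

(** The two children of a node share its weight. *)
Lemma tail_double l m p : tail l.+1 (2 * m) p = tail l m p.
Proof.
rewrite /tail expnS (sum_double (leq (2 * m)) (fun j => weight l.+1 j p)).
rewrite (eq_bigl (fun j : 'I_(2 ^ l) => (m <= j)%N)); last first.
  by move=> j; rewrite leq_pmul2l.
rewrite [X in _ + X = _](eq_bigl (fun j : 'I_(2 ^ l) => (m <= j)%N)); last first.
  by move=> j; lia.
rewrite -big_split/=; apply: eq_bigr => j _.
by rewrite weight_even weight_odd -mulrDr subrK mulr1.
Qed.

Lemma tail_expn l k m p : tail (l + k) (2 ^ k * m) p = tail l m p.
Proof.
elim: k => [|k IH]; first by rewrite addn0 mul1n.
by rewrite addnS expnS -mulnA tail_double.
Qed.

Lemma tail0 l p : tail l 0 p = 1.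
Proof.
have := tail_expn 0 l 0 p; rewrite add0n muln0 => ->.
by rewrite /tail (big_ord_recl 0) big_ord0/= addr0.
Qed.

Lemma sum_weight l p : \sum_(j < 2 ^ l) weight l j p = 1.
Proof. by rewrite -[RHS](tail0 l p). Qed.

Lemma tail_ge0 l m p : 0 <= tail l m p.
Proof. by apply: sumr_ge0 => j _; exact: weight_ge0. Qed.

Lemma tail_le1 l m p : tail l m p <= 1.
Proof.
rewrite -(tail0 l p) /tail big_mkcond/= ler_sum// => j _.
by case: ifP => // _; exact: weight_ge0.
Qed.

Lemma tail_odd l j p : (j < 2 ^ l)%N -> tail l.+1 (2 * j + 1) p = mass l j p.
Proof.
move=> jl; rewrite /mass -(tail_double l) /tail.
have j2 : (2 * j + 1 < 2 ^ l.+1)%N by rewrite expnS; lia.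
rewrite (bigD1 (Ordinal j2)) //=; congr (_ + _); apply: eq_bigl => i.
by rewrite -val_eqE/=; lia.
Qed.

Lemma mass_rank l j p : (l < n)%N -> (j < 2 ^ l)%N -> tail n (rank l j) p = mass l j p.
Proof.
by move=> ln jl; rewrite -tail_odd// /rank -(tail_expn l.+1 (n - l.+1)) subnKC.
Qed.

Lemma mass01 l j p : (j < 2 ^ l)%N -> 0 <= mass l j p <= 1.
Proof. by move=> jl; rewrite -tail_odd// tail_ge0 tail_le1. Qed.

Lemma weight_le1 l j p : (j < 2 ^ l)%N -> weight l j p <= 1.
Proof.
move=> jl; rewrite -(sum_weight l p) (bigD1 (Ordinal jl))//= lerDl.
by apply: sumr_ge0 => i _; exact: weight_ge0.
Qed.

Lemma energy_le1 l p : energy l p <= 1.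
Proof.
rewrite -(sum_weight l p) ler_sum// => j _.
by rewrite expr2 ler_piMl ?weight_ge0 ?weight_le1.
Qed.

Lemma walkS l p : walk l.+1 p = walk l p + \sum_(j < 2 ^ l) node l j p.
Proof. by []. Qed.

(** The weights make the sum a multiple of a convex combination of exponentials of modulus 1. *)
Lemma nrm_sum_node l p : nrm (walk l p) <= 1 ->
  nrm (\sum_(j < 2 ^ l) node l j p) <= c * (1 - nrm (walk l p) ^+ 2).
Proof.
move=> w1; rewrite (le_trans (nrm_sum _ _ _))//.
have /andP[c0 _] := c01.
have x0 : 0 <= c * (1 - nrm (walk l p) ^+ 2).
  by rewrite mulr_ge0 ?(ltW c0)// subr_ge0 expr_le1// nrm_ge0.
rewrite -[leRHS]mulr1 -[X in _ <= _ * X](sum_weight l p) mulr_sumr ler_sum// => j _.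
rewrite Normc.normcM nrm_chr mulr1 nrm_real ger0_norm; first by [].
by apply: mulr_ge0 => //; exact: weight_ge0.
Qed.

(* |X| + c (1 - |X|^2) <= 1 for |X| <= 1 and c <= 1/2. *)
Lemma nrm_walk l p : nrm (walk l p) <= 1.
Proof.
elim: l => [|l IH]; first by rewrite [walk 0 p]/= Normc.normc0.
rewrite walkS (le_trans (le_normcD _ _))// (le_trans (lerD (lexx _) (nrm_sum_node IH)))//.
have := nrm_ge0 (walk l p); move: IH; set t := nrm _ => t1 t0.
have /andP[c0 c1] := c01.
rewrite -subr_ge0 (_ : _ - _ = (1 - t) * (1 - c * (1 + t))); last by ring.
have : c * (1 + t) <= 2^-1 * 2 by rewrite ler_pM//; lra.
by move=> ?; rewrite mulr_ge0//; lra.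
Qed.

Lemma walk_factor_bound l p : 0 <= 1 - nrm (walk l p) ^+ 2 <= 1.
Proof. by rewrite subr_ge0 gerBl sqr_ge0 expr_le1 ?nrm_ge0 ?nrm_walk. Qed.

Lemma kappa_le1 : kappa <= 1.
Proof.
have -> : kappa = mean (fun p => complex.Re (chr e1 p * (phi (complex.Re (chr e1 p)))%:C)).
  by move: kappaE => /(congr1 (@complex.Re R)) /= <-.
rewrite (le_trans (ler_norm _))// mean_norm_le// => [|p].
  by have [] := cbmeasM (cbmeas_chr (R := R) e1) (cbmeas_trig tphi).
rewrite (le_trans (ler_Re_nrm _))// Normc.normcM nrm_chr mul1r nrm_real.
by have /andP[p0 p1] := phi01 (Re_chr_bound e1 p); rewrite ger0_norm.
Qed.

Lemma nrm_noise l p : nrm (noise l p) <= 2 * c.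
Proof.
have /andP[c0 _] := c01; have /andP[x0 x1] := walk_factor_bound l p.
rewrite /noise Normc.normcM nrm_real ger0_norm; last by apply: mulr_ge0 => //; exact: ltW.
set s := nrm (\sum_(_ < _) _).
suff s2 : s <= 2.
  apply: (le_trans (y := c * s)); last by rewrite mulrC ler_pM2r.
  by rewrite ler_wpM2r ?nrm_ge0// ger_pMr.
rewrite /s (le_trans (nrm_sum _ _ _))// -[leRHS]mulr1 -[X in _ <= _ * X](sum_weight l p) mulr_sumr.
apply: ler_sum => j _; rewrite Normc.normcM nrm_real ger0_norm ?weight_ge0//.
rewrite mulrC ler_wpM2r ?weight_ge0// (le_trans (le_normcD _ _))// normcN.
rewrite Normc.normcM nrm_chr mul1r !nrm_real.
have /andP[m0 m1] := mass01 p (ltn_ord j).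
have w0 := weight_ge0 l j p; have w1 := weight_le1 p (ltn_ord j).
have k0 : 0 <= kappa by rewrite (le_trans _ kappa_ge).
rewrite !ger0_norm ?mulr_ge0//.
have : kappa * weight l j p <= 1 by rewrite mulr_ile1// kappa_le1.
by lra.
Qed.

(** The mass contains [weight * phase], and [chr * phase] has mean [kappa]. Adding and subtracting
    [kappa * weight] separates this drift from the noise. *)
Lemma sum_node_mass l p : \sum_(j < 2 ^ l) node l j p * (mass l j p)%:C =
  (c * kappa * ((1 - nrm (walk l p) ^+ 2) * energy l p))%:C + noise l p.
Proof.
rewrite /noise /energy [X in _ = _ + X]mulr_sumr.
rewrite (_ : c * kappa * _ = \sum_(j < 2 ^ l) c * (1 - nrm (walk l p) ^+ 2) * weight l j p *
   (kappa * weight l j p)).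
  rewrite rmorph_sum/= -big_split/=; apply: eq_bigr => j _.
  rewrite /node /node_of !rmorphM/=; set x := (c%:C); set y := (_ - _)%:C; set z := (kappa%:C).
  by set u := (weight l j p)%:C; ring.
by rewrite !mulr_sumr; apply: eq_bigr => j _; ring.
Qed.

Definition prefix_sum w p : R[i] :=
  \sum_(l < n) \sum_(j < 2 ^ l | (rank l j <= w)%N) node l j p.

(* The prefix sum of the leaf w contains a node iff w lies to its right, and the
   mass of a node is the total weight of these leaves. *)
Lemma average_prefix_sum p : \sum_(w < 2 ^ n) (weight n w p)%:C * prefix_sum w p =
  \sum_(l < n) ((c * kappa * ((1 - nrm (walk l p) ^+ 2) * energy l p))%:C + noise l p).
Proof.
under eq_bigr do rewrite mulr_sumr.
rewrite exchange_big/=; apply: eq_bigr => l _.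
rewrite -sum_node_mass.
under eq_bigr do rewrite mulr_sumr big_mkcond/=.
rewrite exchange_big/=; apply: eq_bigr => j _.
rewrite -(mass_rank p (ltn_ord l) (ltn_ord j)) /tail rmorph_sum mulr_sumr/=.
rewrite [RHS]big_mkcond/=; apply: eq_bigr => w _.
by case: ifP => _; rewrite ?mulr0// mulrC.
Qed.

Lemma ReZc (t : R) (z : R[i]) : complex.Re (t%:C * z) = t * complex.Re z.
Proof. by case: z => a b /=; rewrite mul0r subr0. Qed.

(** Some leaf does at least as well as the weighted average over all leaves. The factor [s] will be
    the exponential [chr (N, 0)]. *)
Lemma large_prefix_sum (s : R[i]) p : exists2 w, (w < 2 ^ n)%N &
  `|complex.Re (s * \sum_(l < n) ((c * kappa *
      ((1 - nrm (walk l p) ^+ 2) * energy l p))%:C + noise l p))| <=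
  `|complex.Re (s * prefix_sum w p)|.
Proof.
rewrite -average_prefix_sum mulr_sumr.
set B := `|_|; apply: contrapT => /forall2NP H.
have {}H w : (w < 2 ^ n)%N -> `|complex.Re (s * prefix_sum w p)| < B.
  by move=> wn; case: (H w) => // /negP; rewrite -ltNge.
have Re_sum (I : Type) (r : seq I) (F : I -> R[i]) :
    complex.Re (\sum_(i <- r) F i) = \sum_(i <- r) complex.Re (F i).
  by elim: r => [|i r IH]; rewrite ?big_nil ?big_cons// ReDc IH.
suff : B < B by rewrite ltxx.
have E w : complex.Re (s * ((weight n w p)%:C * prefix_sum w p)) =
    weight n w p * complex.Re (s * prefix_sum w p).
  by rewrite mulrCA ReZc.
rewrite {1}/B Re_sum (le_lt_trans (ler_norm_sum _ _ _))//.
rewrite -[ltRHS]mul1r -[X in _ < X * _](sum_weight n p) mulr_suml.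
(* A leaf of positive weight makes the comparison of the two sums strict. *)
have [w0 w0P] : exists w : 'I_(2 ^ n), 0 < weight n w p.
  apply: contrapT => /forallNP H0.
  have : \sum_(w < 2 ^ n) weight n w p <= 0.
    by apply: sumr_le0 => w _; have /negP := H0 w; rewrite -leNgt.
  by rewrite sum_weight ler10.
rewrite (bigD1 w0)//= [ltRHS](bigD1 w0)//= ltr_leD//.
  rewrite E normrM ger0_norm ?(ltW w0P)// ltr_pM2l//; exact: H.
apply: ler_sum => w _; rewrite E normrM ger0_norm ?weight_ge0//.
by rewrite ler_wpM2l ?weight_ge0// ltW// H.
Qed.

(** * Spectra, orthogonality of the levels and mean estimates *)

Lemma deg_le l : (deg l <= deg l.+1)%N.
Proof. by rewrite /=; lia. Qed.

Lemma deg_homo k l : (k <= l)%N -> (deg k <= deg l)%N.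
Proof. exact: homo_leq leqnn leq_trans deg_le k l. Qed.

Lemma degS l : deg l.+1 = (3 * deg l + q * (D * scale l) + D * scale l)%N.
Proof. by rewrite /= /scale; lia. Qed.

Lemma box_freq l j : box (D * scale l) (freq l j).
Proof.
split; rewrite /freq /=; last by lia.
by rewrite abszN absz_nat leq_mul2r leq_subr orbT.
Qed.

Lemma box_node_chr l j : trig (box (D * scale l)) (chr (freq l j)).
Proof. by constructor; exact: box_freq. Qed.

Lemma high_freq l j : (l < n)%N -> (j < 2 ^ l)%N -> (scale l <= absz (freq l j).1)%N.
Proof.
move=> ln jl; rewrite /freq /= abszN absz_nat leq_pmull// subn_gt0.
apply: leq_trans nD; rewrite /rank.
have -> : (2 ^ n = 2 ^ (n - l.+1) * 2 ^ l.+1)%N by rewrite -expnD subnK.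
by rewrite ltn_pmul2l ?expn_gt0// expnS; lia.
Qed.

Lemma box_phase l j : trig (box (q * (D * scale l))) (fun p => (phase l j p)%:C).
Proof.
exact: (box_along (H := fun z => (phi (complex.Re z))%:C) tphi (box_freq l j)).
Qed.

Lemma box_weight l j : trig (box (deg l)) (fun p => (weight l j p)%:C).
Proof.
elim: l j => [|l IH] j; first exact: (box_cst 0 1%:C).
have tp := box_phase l j./2.
apply: (eq_trig (F := fun p => (weight l j./2 p)%:C *
   (if odd j then (phase l j./2 p)%:C else 1 - (phase l j./2 p)%:C))) => [p|].
  by rewrite [weight l.+1 j p]/weight -/weight; case: ifP; rewrite ?rmorphM ?rmorphB ?rmorph1.
apply: (boxS (d := deg l + q * (D * scale l))); first by rewrite degS; lia.
apply: boxM => //; case: (odd j) => //.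
by apply: trigB => //; exact: box_cst.
Qed.

Lemma box_factor l : trig (box (deg l)) (walk l) ->
  trig (box (2 * deg l)) (fun p => (c * (1 - nrm (walk l p) ^+ 2))%:C).
Proof.
move=> /box_nrm2; rewrite addnn -mul2n => tw.
apply: (eq_trig (F := fun p => c%:C * (1 - (nrm (walk l p) ^+ 2)%:C))) => [p|].
  by rewrite [RHS]rmorphM/= [(1 - _)%:C]rmorphB/=.
by apply: trigZ; apply: trigB => //; exact: box_cst.
Qed.

Lemma box_coef l j : trig (box (deg l)) (walk l) ->
  trig (box (3 * deg l)) (fun p => (c * (1 - nrm (walk l p) ^+ 2) * weight l j p)%:C).
Proof.
move=> tw; under eq_fun do rewrite rmorphM.
by rewrite (mulSn 2) addnC; apply: boxM; [exact: box_factor|exact: box_weight].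
Qed.

Lemma box_walk l : trig (box (deg l)) (walk l).
Proof.
elim: l => [|l IH]; first exact: trig0.
apply: trigD; first exact: boxS (deg_le l) IH.
apply: trig_sum => j _; apply: (boxS (d := 3 * deg l + D * scale l)).
  by rewrite degS; lia.
by apply: boxM; [exact: box_coef|exact: box_node_chr].
Qed.

(** Coefficients of degree [3 * deg l] cannot bring first frequencies of size [scale l] down to
    [deg l]: the increment is orthogonal to the past of the walk. *)
Lemma high_sum_node l : (l < n)%N ->
  trig (high (deg l + 1)) (fun p => \sum_(j < 2 ^ l) node l j p).
Proof.
move=> ln; apply: trig_sum => j _.
apply: (highS (d := scale l - 3 * deg l)); first by rewrite /scale; lia.
apply: highM; first by apply: box_coef; exact: box_walk.
by constructor; exact: high_freq.
Qed.

Lemma bmeas_box d (u : R * R -> R) : trig (box d) (fun p => (u p)%:C) -> bmeas u.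
Proof. by move=> /cbmeas_trig[]. Qed.

(** The increments are orthogonal and bounded by [c]. *)
Lemma mean_walk l : (l <= n)%N ->
  mean (fun p => nrm (walk l p) ^+ 2) <= l%:R * c ^+ 2.
Proof.
elim: l => [_|l IH ln].
  rewrite mul0r (_ : (fun p => _) = fun=> 0) ?mean_cst//.
  by apply/funext => p; rewrite [walk 0 p]/= Normc.normc0 expr0n.
rewrite (mean_nrm2D _ (box_walk l) (high_sum_node ln)); last by rewrite addn1.
rewrite -natr1 mulrDl mul1r lerD//; first by apply: IH; exact: ltnW.
have /andP[c0 _] := c01.
rewrite -(mean_cst (c ^+ 2)); apply: ler_mean => [||p].
- by apply: bmeas_nrm2; exact: cbmeas_trig (high_sum_node ln).
- exact: bmeas_cst.
rewrite ler_sqr ?nnegrE ?nrm_ge0 ?(ltW c0)// (le_trans (nrm_sum_node (nrm_walk l p)))//.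
by have /andP[? ?] := walk_factor_bound l p; rewrite ger_pMr.
Qed.

Lemma box_tail l m : trig (box (deg l)) (fun p => (tail l m p)%:C).
Proof.
rewrite /tail; under eq_fun do rewrite rmorph_sum.
by apply: trig_sum => j _; exact: box_weight.
Qed.

Lemma box_mass l j : trig (box (deg l.+1)) (fun p => (mass l j p)%:C).
Proof.
rewrite /mass; under eq_fun do rewrite rmorphD.
by apply: trigD; [exact: box_weight|exact: boxS (deg_le l) (box_tail l _)].
Qed.

Lemma box_noise l : trig (box (2 * deg l.+1)) (noise l).
Proof.
apply: (boxS (d := 2 * deg l + (deg l + (D * scale l + deg l.+1)))).
  by rewrite degS; lia.
apply: boxM; first by apply: box_factor; exact: box_walk.
apply: trig_sum => j _; apply: boxM; first exact: box_weight.
apply: trigB; first by apply: boxM; [exact: box_node_chr|exact: box_mass].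
under eq_fun do rewrite rmorphM; apply: trigZ.
by apply: boxS (box_weight l j); rewrite degS; lia.
Qed.

Lemma high_noise l : (l < n)%N -> trig (high (2 * deg l + 1)) (noise l).
Proof.
move=> ln; apply: (highS (d := scale l - 2 * deg l - 2 * deg l)).
  by rewrite /scale; lia.
apply: highM; first by apply: box_factor; exact: box_walk.
apply: trig_sum => j _.
have K1 := high_freq ln (ltn_ord j).
pose H (z : R[i]) := z * (phi (complex.Re z))%:C.
have tH : trig (box (1 + q)) (fun p => H (chr e1 p)).
  by apply: boxM => //; constructor; split.
(* By [mass = weight * phase + tail], the term splits along [chr] and the centered [chr * phase].
   Both have high frequencies, and their factors have degree [deg l]. *)
apply: (eq_trig (F := fun p => (weight l j p)%:C * ((tail l j.+1 p)%:C * chr (freq l j) p +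
    (weight l j p)%:C * (H (chr (freq l j) p) - cmean (fun p => H (chr e1 p)))))) => [p|].
  rewrite kappaE /mass weight_odd /H -/(phase l j p) rmorphD/= !rmorphM/=.
  by set a := (weight _ _ _)%:C; set b := (tail _ _ _)%:C; set z := chr _ _; ring.
apply: (highS (d := scale l - deg l - deg l)); first by lia.
apply: (highS (d := (scale l - deg l) - deg l)); first by lia.
apply: highM; first exact: box_weight.
apply: trigD.
  by apply: highM; [exact: box_tail|constructor].
by apply: highM; [exact: box_weight|exact: highS K1 (high_along _ tH)].
Qed.

(** The noises behave like martingale differences: they are orthogonal across levels, and each is
    bounded by [2 * c]. *)
Lemma mean_sum_noise l : (l <= n)%N ->
  mean (fun p => nrm (\sum_(k < l) noise k p) ^+ 2) <= l%:R * (2 * c) ^+ 2.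
Proof.
have tB k : trig (box (2 * deg k)) (fun p => \sum_(i < k) noise i p).
  apply: trig_sum => i _; apply: boxS (box_noise i).
  by rewrite leq_mul2l deg_homo.
elim: l => [_|l IH ln].
  rewrite mul0r (_ : (fun p => _) = fun=> 0) ?mean_cst//.
  by apply/funext => p; rewrite big_ord0 Normc.normc0 expr0n.
under eq_fun do rewrite big_ord_recr/=.
rewrite (mean_nrm2D _ (tB l) (high_noise ln)); last by rewrite addn1.
rewrite -natr1 mulrDl mul1r lerD//; first by apply: IH; exact: ltnW.
rewrite -(mean_cst ((2 * c) ^+ 2)); apply: ler_mean => [||p].
- by apply: bmeas_nrm2; exact: cbmeas_trig (high_noise ln).
- exact: bmeas_cst.
have /andP[c0 _] := c01.
by rewrite ler_sqr ?nnegrE ?nrm_ge0 ?nrm_noise// mulr_ge0// ltW.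
Qed.

Lemma tau_ge0 : 0 <= tau.
Proof.
rewrite -tauE -(mean_cst 0); apply: ler_mean => [||p]; first exact: bmeas_cst.
  have bp := bmeas_box tphi.
  by apply: bmeasM => //; apply: bmeasB => //; exact: bmeas_cst.
by have /andP[? ?] := phi01 (Re_chr_bound e1 p); rewrite mulr_ge0// subr_ge0.
Qed.

Lemma bmeas_weight l j : bmeas (weight l j).
Proof. exact: bmeas_box (box_weight l j). Qed.

Lemma bmeas_phase l j : bmeas (phase l j).
Proof. exact: bmeas_box (box_phase l j). Qed.

(** Minus its mean [tau], the product [phase * (1 - phase)] has only high frequencies, whereas
    [weight ^+ 2] has low degree: the two are uncorrelated. *)
Lemma mean_weight_phase l j : (l < n)%N -> (j < 2 ^ l)%N ->
  mean (fun p => weight l j p ^+ 2 * (phase l j p * (1 - phase l j p))) =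
  tau * mean (fun p => weight l j p ^+ 2).
Proof.
move=> ln jl; have K1 := high_freq ln jl.
pose H (z : R[i]) : R[i] := (phi (complex.Re z) * (1 - phi (complex.Re z)))%:C.
have tH : trig (box (q + q)) (fun p => H (chr e1 p)).
  rewrite /H; under eq_fun do rewrite rmorphM; apply: boxM => //.
  under eq_fun do rewrite rmorphB rmorph1.
  by apply: trigB => //; exact: box_cst.
have aE : cmean (fun p => H (chr e1 p)) = tau%:C.
  apply/eqP; rewrite eq_complex; apply/andP; split; apply/eqP; first exact: tauE.
  exact: mean_cst.
have tw2 : trig (box (deg l + deg l)) (fun p => (weight l j p ^+ 2)%:C).
  under eq_fun do rewrite expr2 rmorphM.
  by apply: boxM; exact: box_weight.
have := highM tw2 (highS K1 (high_along (freq l j) tH)).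
rewrite aE => tE.
have E0 : mean (fun p => complex.Re ((weight l j p ^+ 2)%:C *
    (H (chr (freq l j) p) - tau%:C))) = 0.
  have C0 := cmean_high _ tE.
  by have [-> _] := C0 ltac:(rewrite /scale; lia).
have E p : complex.Re ((weight l j p ^+ 2)%:C * (H (chr (freq l j) p) - tau%:C)) =
    weight l j p ^+ 2 * (phase l j p * (1 - phase l j p)) - tau * weight l j p ^+ 2.
  rewrite ReZc /H -rmorphB [complex.Re _%:C]/= /phase.
  by rewrite mulrBr [X in _ - X]mulrC.
move: E0; under eq_fun do rewrite E.
have bw2 := bmeas_box tw2.
have bphi := bmeas_phase l j.
rewrite meanB ?meanZ//; first by move/eqP; rewrite subr_eq0 => /eqP.
- apply: bmeasM => //; apply: bmeasM => //; apply: bmeasB => //; exact: bmeas_cst.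
- by apply: bmeasM => //; exact: bmeas_cst.
Qed.

Lemma bmeas_energy l : bmeas (energy l).
Proof.
apply: bmeas_sum => j; under eq_fun do rewrite expr2.
by apply: bmeasM; exact: bmeas_weight.
Qed.

(** Splitting a node replaces [u^2] by [u^2 (t^2 + (1 - t)^2) = u^2 - 2 u^2 t (1 - t)], so a level
    costs at most [2 * tau] on average. *)
Lemma mean_energy l : (l <= n)%N -> 1 - l%:R * (2 * tau) <= mean (energy l).
Proof.
have bw k i : bmeas (fun p => weight k i p ^+ 2).
  by under eq_fun do rewrite expr2; apply: bmeasM; exact: bmeas_weight.
elim: l => [_|l IH ln].
  rewrite mul0r subr0 (_ : energy 0 = fun=> 1) ?mean_cst//.
  by apply/funext => p; rewrite /energy (big_ord_recl 0) big_ord0 addr0 expr1n.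
have bwp i : bmeas (fun p => weight l i p ^+ 2 * (phase l i p * (1 - phase l i p))).
  apply: bmeasM => //; apply: bmeasM; first exact: bmeas_phase.
  by apply: bmeasB; [exact: bmeas_cst|exact: bmeas_phase].
have -> : energy l.+1 = fun p => energy l p - 2 * \sum_(j < 2 ^ l)
    weight l j p ^+ 2 * (phase l j p * (1 - phase l j p)).
  apply/funext => p; rewrite /energy expnS (sum_double predT (fun j => weight l.+1 j p ^+ 2)).
  rewrite -big_split mulr_sumr -sumrB; apply: eq_bigr => j _ /=.
  by rewrite weight_even weight_odd; ring.
rewrite meanB; [|exact: bmeas_energy|by apply: bmeasM; [exact: bmeas_cst|exact: bmeas_sum]].
rewrite meanZ; last exact: bmeas_sum.
rewrite [X in _ - 2 * X]mean_sum//.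
rewrite (eq_bigr (fun j : 'I_(2 ^ l) => tau * mean (fun p => weight l j p ^+ 2))); last first.
  by move=> j _; exact: (mean_weight_phase ln (ltn_ord j)).
rewrite -mulr_sumr -(mean_sum _ (F := fun (j : 'I_(2 ^ l)) p => weight l j p ^+ 2))//.
rewrite -/(energy l).
have := IH (ltnW ln).
have : mean (energy l) <= 1.
  rewrite -(mean_cst 1); apply: ler_mean => [||p]; [exact: bmeas_energy|exact: bmeas_cst|].
  exact: energy_le1.
have := tau_ge0 => t0 m1 h.
have : tau * mean (energy l) <= tau by rewrite ler_piMr.
rewrite -natr1 mulrDl mul1r; lra.
Qed.

(** * The rhombi and the partial sums of the block polynomial *)

Variable N : nat.
Hypothesis nN : (deg n <= N)%N.
Hypothesis N0 : (0 < N)%N.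

Lemma D_gt0 : (0 < D)%N.
Proof. by apply: leq_trans nD; rewrite expn_gt0. Qed.

Lemma rank_gt0 l j : (0 < rank l j)%N.
Proof. by rewrite /rank muln_gt0 expn_gt0 addn1. Qed.

Lemma rank_lt l j : (l < n)%N -> (j < 2 ^ l)%N -> (rank l j < D)%N.
Proof.
move=> ln jl; apply: leq_trans nD; rewrite /rank.
have -> : (2 ^ n = 2 ^ (n - l.+1) * 2 ^ l.+1)%N by rewrite -expnD subnK.
by rewrite ltn_pmul2l ?expn_gt0// expnS; lia.
Qed.

(* The side through (N, 0) of Delta N^-1 (slope w) runs between the frequencies
   of the nodes of rank w and w + 1. *)
Definition slope w : R := (2 * D - 2 * w - 1)%N%:R / (2 * D * N)%N%:R.

(** Clearing denominators turns membership into integer arithmetic. *)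
Lemma lattice_DeltaP w (k : int * int) : (w < D)%N -> lattice (Delta N%:R^-1 (slope w)) k <->
  (2 * D * absz k.1 + (2 * D - 2 * w - 1) * absz k.2 <= 2 * D * N)%N.
Proof.
move=> wD; have D0 := D_gt0; rewrite /lattice /Delta /= /slope.
have D0' : 0 < D%:R :> R by rewrite ltr0n.
have N0' : 0 < N%:R :> R by rewrite ltr0n.
have e : (2 * D * N)%N%:R = 2 * D%:R * N%:R :> R by rewrite !natrM.
rewrite -(ler_nat R) natrD !natrM.
have aE (m : int) : `|m%:~R| = (absz m)%:R :> R by rewrite -intr_norm -abszE.
rewrite !aE -[X in X <= 1 <-> _](mulfK (lt0r_neq0 (mulr_gt0 (mulr_gt0 (ltr0Sn R 1) D0') N0'))).
rewrite ler_pdivrMr ?mul1r ?mulr_gt0//.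
rewrite (_ : _ * (2 * _ * _) = 2 * D%:R * (absz k.1)%:R +
  (2 * D - 2 * w - 1)%N%:R * (absz k.2)%:R)//.
by field; rewrite !lt0r_neq0.
Qed.

(** The allowed error [3 * deg l] is the degree of the coefficient in front of the exponential. *)
Definition node_spectrum l j : set (int * int) :=
  [set k : int * int | (absz (k.1 - N%:Z - (freq l j).1)%R <= 3 * deg l)%N /\
           (absz (k.2 - (freq l j).2)%R <= 3 * deg l)%N].

Lemma trig_node l j :
  trig (node_spectrum l j) (fun p => chr (N%:Z, 0) p * node l j p).
Proof.
have tN : trig [set (N%:Z, 0)] (chr (N%:Z, 0)) by constructor.
have tn : trig [set k : int * int | (absz (k.1 - (freq l j).1)%R <= 3 * deg l)%N /\
           (absz (k.2 - (freq l j).2)%R <= 3 * deg l)%N] (node l j).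
  apply: (trigM (T := [set freq l j]) (box_coef j (box_walk l))); first by constructor.
  by move=> [a b] _ [/= ? ?] ->; split => /=; rewrite addrK.
apply: (trigM tN tn) => _ [a b] -> [/= ? ?].
by split => /=; lia.
Qed.

(** As [N] dominates the node frequencies, both coordinates are nonnegative and the absolute values
    disappear; [u] and [v] are the deviations from the exact frequency. *)
Lemma node_spectrumP l j (k : int * int) : (l < n)%N -> (j < 2 ^ l)%N -> node_spectrum l j k ->
  exists u v : int, [/\ `|u| <= 3 * (deg l)%:Z, `|v| <= 3 * (deg l)%:Z,
    (absz k.1)%:Z = N%:Z - (D%:Z - (rank l j)%:Z) * (scale l)%:Z + u,
    (absz k.2)%:Z = D%:Z * (scale l)%:Z + v &
    D%:Z * (scale l)%:Z + 3 * (deg l)%:Z <= N%:Z].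
Proof.
move=> ln jl; have rD := rank_lt ln jl; have r0 := rank_gt0 l j; have D0 := D_gt0.
have dN : (3 * deg l + D * scale l <= N)%N.
  by apply: leq_trans nN; apply: leq_trans (deg_homo ln); rewrite degS; lia.
case: k => a b; rewrite /node_spectrum /freq /= => -[ha hb].
exists (a - N%:Z + ((D - rank l j) * scale l)%N%:Z), (b - (D * scale l)%N%:Z).
have e1 : ((D - rank l j) * scale l)%N%:Z = (D%:Z - (rank l j)%:Z) * (scale l)%:Z.
  by rewrite PoszM subzn// ltnW.
have e2 : (D * scale l)%N%:Z = D%:Z * (scale l)%:Z by rewrite PoszM.
have h1 : ((D - rank l j) * scale l <= D * scale l)%N by rewrite leq_mul2r leq_subr orbT.
have h2 : (scale l <= D * scale l)%N by rewrite leq_pmull.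
have h3 : (20 * deg l <= scale l)%N by rewrite /scale leq_addr.
rewrite -e1 -e2; split; lia.
Qed.

Lemma node_spectrum_in w l j : (w < D)%N -> (l < n)%N -> (j < 2 ^ l)%N ->
  (rank l j <= w)%N -> node_spectrum l j `<=` lattice (Delta N%:R^-1 (slope w)).
Proof.
move=> wD ln jl rw k /(node_spectrumP ln jl)[u [v [u1 v1 k1 k2 _]]].
apply/(lattice_DeltaP k wD); rewrite -lez_nat PoszD !PoszM k1 k2.
have wE : (2 * D - 2 * w - 1)%N%:Z = 2 * D%:Z - 2 * w%:Z - 1 by lia.
rewrite wE -subr_ge0.
set d := (deg l)%:Z in u1 v1 *; set r := (rank l j)%:Z.
have sE : (scale l)%:Z = 20 * d + 20 by rewrite /scale PoszD PoszM.
(* The first product is the margin of the exact frequency, at least [D * (20 * d + 20)]; the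
   deviations [u] and [v] together cost at most [12 * D * d]. *)
have -> : 2 * D%:Z * N%:Z - (2 * D%:Z * (N%:Z - (D%:Z - r) * (scale l)%:Z + u) +
   (2 * D%:Z - 2 * w%:Z - 1) * (D%:Z * (scale l)%:Z + v)) =
   D%:Z * ((scale l)%:Z * (2 * (w%:Z - r) + 1)) - D%:Z * (2 * u)
   - (2 * (D%:Z - w%:Z) - 1) * v by ring.
have rwz : 0 <= w%:Z - r by rewrite /r; lia.
have d0 : 0 <= d by rewrite /d; lia.
have h1 : D%:Z * (20 * d + 20) <= D%:Z * ((scale l)%:Z * (2 * (w%:Z - r) + 1)).
  by rewrite ler_wpM2l// sE ler_peMr//; lia.
have h2 : D%:Z * (2 * u) <= D%:Z * (6 * d) by rewrite ler_wpM2l//; lia.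
have h3 : (2 * (D%:Z - w%:Z) - 1) * v <= (2 * D%:Z) * (3 * d).
  apply: (le_trans (y := (2 * (D%:Z - w%:Z) - 1) * (3 * d))).
    by rewrite ler_wpM2l//; lia.
  by rewrite ler_wpM2r//; lia.
have h4 : 0 <= D%:Z * d by rewrite mulr_ge0.
have : D%:Z * (20 * d + 20) = 20 * (D%:Z * d) + 20 * D%:Z by ring.
have : D%:Z * (6 * d) = 6 * (D%:Z * d) by ring.
have : 2 * D%:Z * (3 * d) = 6 * (D%:Z * d) by ring.
by lia.
Qed.

Lemma node_spectrum_out w l j : (w < D)%N -> (l < n)%N -> (j < 2 ^ l)%N ->
  (w < rank l j)%N -> node_spectrum l j `<=` ~` lattice (Delta N%:R^-1 (slope w)).
Proof.
move=> wD ln jl rw k /(node_spectrumP ln jl)[u [v [u1 v1 k1 k2 _]]].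
have D0 := D_gt0.
move=> /(lattice_DeltaP k wD); rewrite -lez_nat PoszD !PoszM k1 k2.
have wE : (2 * D - 2 * w - 1)%N%:Z = 2 * D%:Z - 2 * w%:Z - 1 by lia.
rewrite wE -subr_ge0.
set d := (deg l)%:Z in u1 v1 *; set r := (rank l j)%:Z.
have sE : (scale l)%:Z = 20 * d + 20 by rewrite /scale PoszD PoszM.
(* The margin now has the opposite sign; [2 * (r - w) - 1 >= 1] because [slope] cuts halfway between
   the ranks. *)
have -> : 2 * D%:Z * N%:Z - (2 * D%:Z * (N%:Z - (D%:Z - r) * (scale l)%:Z + u) +
   (2 * D%:Z - 2 * w%:Z - 1) * (D%:Z * (scale l)%:Z + v)) =
   D%:Z * (2 * - u) + (2 * (D%:Z - w%:Z) - 1) * - v -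
   D%:Z * ((scale l)%:Z * (2 * (r - w%:Z) - 1)) by ring.
have rwz : 1 <= r - w%:Z by rewrite /r; lia.
have d0 : 0 <= d by rewrite /d; lia.
have h1 : D%:Z * (20 * d + 20) <= D%:Z * ((scale l)%:Z * (2 * (r - w%:Z) - 1)).
  by rewrite ler_wpM2l// sE ler_peMr//; lia.
have h2 : D%:Z * (2 * - u) <= D%:Z * (6 * d) by rewrite ler_wpM2l//; lia.
have h3 : (2 * (D%:Z - w%:Z) - 1) * - v <= (2 * D%:Z) * (3 * d).
  apply: (le_trans (y := (2 * (D%:Z - w%:Z) - 1) * (3 * d))).
    by rewrite ler_wpM2l//; lia.
  by rewrite ler_wpM2r//; lia.
have h4 : 0 <= D%:Z * d by rewrite mulr_ge0.
have : D%:Z * (20 * d + 20) = 20 * (D%:Z * d) + 20 * D%:Z by ring.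
have : D%:Z * (6 * d) = 6 * (D%:Z * d) by ring.
have : 2 * D%:Z * (3 * d) = 6 * (D%:Z * d) by ring.
by lia.
Qed.

Definition block_poly p : R := complex.Re (chr (N%:Z, 0) p * walk n p).

Lemma block_poly_le1 p : `|block_poly p| <= 1.
Proof. by rewrite (le_trans (ler_Re_nrm _))// Normc.normcM nrm_chr mul1r nrm_walk. Qed.

Lemma walkE m p : walk m p = \sum_(l < m) \sum_(j < 2 ^ l) node l j p.
Proof. by elim: m => [|m IH]; rewrite ?big_ord0// big_ord_recr/= -IH. Qed.

Lemma Re_trig S F : (forall k : int * int, S k -> S (- k)) -> trig S F ->
  trig S (fun p => (complex.Re (F p))%:C).
Proof.
move=> SN tF; apply: (eq_trig (F := fun p => 2^-1 * (F p + (F p)^* ))) => [p|].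
  by rewrite addcJ mulrA mulVf ?mul1r// pnatr_eq0.
apply: trigZ; apply: trigD => //; apply: trigS (trigJ tF) => k /= Sk.
by rewrite -(opprK k); exact: SN.
Qed.

Definition annulus (r1 r2 : nat) : set (int * int) :=
  [set k : int * int | (r1 < absz k.1 + absz k.2)%N /\ (absz k.1 + absz k.2 <= r2)%N].

(** At a node the coordinates add up to [N + rank * scale], with an error of at most [6 * deg]. This
    exceeds [N] since ranks are positive, and [deg n <= N] bounds it by [3 * N]. The annulus is
    symmetric, so the real part stays in it. *)
Lemma trig_block_poly : trig (annulus N (3 * N)) (fun p => (block_poly p)%:C).
Proof.
rewrite /block_poly; apply: Re_trig.
  by move=> [a b]; rewrite /annulus/= !abszN.
under eq_fun do rewrite walkE mulr_sumr; apply: trig_sum => l _.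
under eq_fun do rewrite mulr_sumr; apply: trig_sum => j _.
apply: trigS (trig_node l j) => k /(node_spectrumP (ltn_ord l) (ltn_ord j)).
move=> [u [v [u1 v1 k1 k2 dN]]].
have r0 := rank_gt0 l j; have rD := rank_lt (ltn_ord l) (ltn_ord j).
set d := (deg l)%:Z in u1 v1 dN; set r := (rank l j)%:Z in k1.
have sE : (scale l)%:Z = 20 * d + 20 by rewrite /scale PoszD PoszM.
have d0 : 0 <= d by rewrite /d; lia.
have h : (scale l)%:Z <= r * (scale l)%:Z by rewrite ler_peMl// /r; lia.
have h' : r * (scale l)%:Z <= D%:Z * (scale l)%:Z by rewrite ler_wpM2r// /r; lia.
have e : (D%:Z - r) * (scale l)%:Z = D%:Z * (scale l)%:Z - r * (scale l)%:Z by ring.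
by rewrite e in k1; split; lia.
Qed.

Lemma slope_gt0 w : (w < D)%N -> 0 < slope w.
Proof.
move=> wD; have D0 := D_gt0; rewrite /slope divr_gt0// ltr0n; first by lia.
by rewrite !muln_gt0 N0 D0.
Qed.

(** The rank decides whether the whole spectrum of a node lies inside or outside the rhombus. By
    symmetry of the rhombus the real part splits in the same way. *)
Lemma partial_sum_block_poly w p : (w < D)%N ->
  partial_sum (Delta N%:R^-1 (slope w)) p (fun p => (block_poly p)%:C) =
  (complex.Re (chr (N%:Z, 0) p * prefix_sum w p))%:C.
Proof.
move=> wD; set Dl := Delta _ _.
have Ninv : 0 < N%:R^-1 :> R by rewrite invr_gt0 ltr0n.
have finD : finite_set (lattice Dl) by apply: finite_lattice_Delta => //; exact: slope_gt0.
have DN (k : int * int) : lattice Dl k -> lattice Dl (- k).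
  by rewrite /lattice /Dl /Delta /= !intrN !normrN.
pose Pin p := chr (N%:Z, 0) p * prefix_sum w p.
pose Pout p := chr (N%:Z, 0) p *
  \sum_(l < n) \sum_(j < 2 ^ l | ~~ (rank l j <= w)%N) node l j p.
have tin : trig (lattice Dl) Pin.
  rewrite /Pin /prefix_sum; under eq_fun do rewrite mulr_sumr; apply: trig_sum => l _.
  under eq_fun do rewrite mulr_sumr; apply: trig_sum => j jr.
  by apply: trigS (trig_node l j); exact: node_spectrum_in.
have tout : trig (~` lattice Dl) Pout.
  rewrite /Pout; under eq_fun do rewrite mulr_sumr; apply: trig_sum => l _.
  under eq_fun do rewrite mulr_sumr; apply: trig_sum => j; rewrite -ltnNge => jr.
  by apply: trigS (trig_node l j); exact: node_spectrum_out.
have tin' := Re_trig DN tin.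
have tout' : trig (~` lattice Dl) (fun p => (complex.Re (Pout p))%:C).
  by apply: Re_trig tout => k Dk Dk'; apply: Dk; rewrite -(opprK k); exact: DN.
have E : (fun p => (block_poly p)%:C) =
    (fun p => (complex.Re (Pin p))%:C + (complex.Re (Pout p))%:C).
  apply/funext => x; rewrite -rmorphD/= -ReDc -mulrDr /prefix_sum -big_split/=.
  rewrite /block_poly walkE; congr (complex.Re (_ * _))%:C; apply: eq_bigr => l _.
  by rewrite (bigID (fun j : 'I_(2 ^ l) => (rank l j <= w)%N)).
rewrite E partial_sumD//; [|exact: cbmeas_trig tin'|exact: cbmeas_trig tout'].
rewrite (partial_sum_in finD _ _ tin')//.
by rewrite (partial_sum_out finD _ _ tout')// addr0.
Qed.

End Block.

(** * Choice of the parameters of a block *)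

Section BlockExistence.
Context {R : realType}.
Implicit Types (p : R * R) (w : nat).

Local Notation chr := (@character R).
Local Notation nrm := (@Normc.normc R).

(** The function [G] encodes the exceptional set: it has small mean and is at least 1 wherever no
    partial sum is large, ready for Markov's inequality. [block_bounds] places the rhombi between
    the l1-balls of radii [N] and [3 * N], for the interlacing of the blocks. *)
Record block_spec (M delta eps : R) (N0 : nat) (P G : R * R -> R) (s N : nat)
    (b : nat -> R) : Prop := BlockSpec {
  block_N : (N0 <= N)%N;
  block_N_gt0 : (0 < N)%N;
  block_size : (0 < s)%N;
  block_trig : trig (annulus N (3 * N)) (fun p => (P p)%:C);
  block_le1 : forall p, `|P p| <= 1;
  block_bmeas : bmeas G;
  block_mean : mean G <= delta;
  block_ge0 : forall p, 0 <= G p;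
  block_bounds : forall w, (w < s)%N -> (3 * N)%N%:R^-1 <= b w <= N%:R^-1;
  block_rho : forall w, (w < s)%N -> N%:R^-1 / b w <= 1 + eps;
  block_mono : forall w, (w.+1 < s)%N -> b w.+1 <= b w;
  block_large : forall p, G p < 1 -> exists w t, [/\ (w < s)%N,
    partial_sum (Delta N%:R^-1 (b w)) p (fun p => (P p)%:C) = t%:C & M <= `|t|] }.

Lemma block_exists (M delta eps : R) (N0 : nat) : 0 < delta -> 0 < eps ->
  exists P G s N b, block_spec M delta eps N0 P G s N b.
Proof.
move=> d0 e0; have eqle (x y : R) : x = y -> x <= y by move->.
have [|Psi [eta [qPsi [eta0 Psi0 tPsi mPsi Psi1]]]] := @fejer R (delta / 4).
  by rewrite divr_gt0.
(* The walk has [n = k^2] steps of size [c = s / k]: the variance [n c^2 = s^2] is small compared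
   with [delta], while the drift, of order [c n = s k], beats [M] for large [k]. *)
pose s := Num.min 2^-1 (delta / 24).
have s0 : 0 < s by rewrite lt_min invr_gt0 ltr0n divr_gt0.
have s1 : s <= 2^-1 by rewrite ge_min lexx.
have s2 : s <= delta / 24 by rewrite ge_min lexx orbT.
have [k k1 kM] : exists2 k, 1 <= k%:R :> R & 8 * (`|M| + 1) <= eta * s * k%:R.
  exists (Num.truncn (8 * (`|M| + 1) / (eta * s))).+1; first by rewrite ler1n.
  by rewrite [leRHS]mulrC -ler_pdivrMr ?mulr_gt0// ltW// truncnS_gt.
have k0 : 0 < k%:R :> R by rewrite (lt_le_trans _ k1).
have [n nE] : exists n, n%:R = k%:R ^+ 2 :> R by exists (k ^ 2)%N; rewrite natrX.
have n0 : 0 < n%:R :> R by rewrite nE exprn_gt0.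
pose c := s / k%:R.
have c0 : 0 < c by rewrite divr_gt0.
have c01 : 0 < c <= 2^-1.
  by rewrite c0 (le_trans _ s1)// /c ler_pdivrMr// ler_peMr// ltW.
have ck : c * k%:R = s by rewrite /c mulfVK// lt0r_neq0.
(* With [tau <= delta / (16 n)] the mean energy loses at most [delta / 8] over the [n] levels. *)
have [|phi [kappa [q [phi01 tphi kappaE kappa4 tau_le]]]] :=
  @sharp_switch R (delta / (16 * n%:R)).
  by apply: divr_gt0 => //; apply: mulr_gt0.
set tau := mean _ in tau_le; have tauE := erefl tau; rewrite {1}/tau in tauE.
have [m m1] : exists m, eps^-1 < m.+1%:R by exists (Num.truncn eps^-1); rewrite truncnS_gt.
(* As [w < 2 ^ n], the factor [m + 2] with [m + 1 > 1 / eps] makes the ratio [2D / (2D - 2w - 1)] of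
   a rhombus at most [1 + eps]. *)
pose D := (2 ^ n * m.+2)%N.
have nD : (2 ^ n <= D)%N by rewrite leq_pmulr.
have [N [nN N0N N0']] : exists N, [/\ deg D q n <= N, N0 <= N & 0 < N]%N.
  exists (deg D q n + N0).+1.
  by split=> //; apply: leqW; rewrite ?leq_addr ?leq_addl.
pose X := walk n D q c phi; pose E := energy n D q phi.
pose U := noise n D q c kappa phi.
pose B p := \sum_(l < n) U l p.
pose Z p := \sum_(l < n) (nrm (X l p) ^+ 2 + (1 - E l p)).
(* Three ways to fail: a large noise, a walk too large or an energy too low on average over the
   levels, and a value of [cos (N x)] near 0. The mean is at most
   [4 s^2 + 2 (s^2 + delta / 8) + delta / 4], which is below [delta]. *)
pose G p := nrm (B p) ^+ 2 + (2 / n%:R * Z p + Psi (chr (N%:Z, 0) p)).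
have X2 l p : 0 <= nrm (X l p) ^+ 2 <= 1.
  by rewrite sqr_ge0 expr_le1 ?nrm_ge0 ?(nrm_walk q phi01 c01 kappa4 nD).
have E1 l p : E l p <= 1 by exact: (energy_le1 q phi01 c01 kappa4 nD).
have Z0 p : 0 <= Z p.
  apply: sumr_ge0 => l _; have /andP[? _] := X2 l p.
  by rewrite addr_ge0// subr_ge0.
have tB : cbmeas B.
  suff: trig setT B by exact: cbmeas_trig.
  by apply: trig_sum => l _; apply: trigS (box_noise c01 tphi kappa4 nD l).
have bX l : bmeas (fun p => nrm (X l p) ^+ 2).
  by apply: bmeas_nrm2; exact: cbmeas_trig (box_walk c01 tphi kappa4 nD l).
have bE l : bmeas (E l) by exact: (bmeas_energy c01 tphi kappa4 nD).
have bXE l : bmeas (fun p => nrm (X l p) ^+ 2 + (1 - E l p)).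
  by apply: bmeasD => //; apply: bmeasB => //; exact: bmeas_cst.
have bZ : bmeas Z by apply: bmeas_sum.
have bPsi : bmeas (fun p => Psi (chr (N%:Z, 0) p)).
  apply: (bmeas_box (d := (qPsi * N)%N)).
  by apply: (box_along (H := fun z => (Psi z)%:C) tPsi); split; rewrite /= ?absz_nat.
have bZ' : bmeas (fun p => 2 / n%:R * Z p) by apply: bmeasM => //; exact: bmeas_cst.
have Nz : N%:Z != 0 by rewrite eqz_nat -lt0n.
have mPsi' : mean (fun p => Psi (chr (N%:Z, 0) p)) <= delta / 4.
  have /(congr1 (@complex.Re R)) := @cmean_along R qPsi (fun z => (Psi z)%:C) (N%:Z, 0) tPsi Nz.
  rewrite -[LHS]/(mean (fun p => Psi (chr (N%:Z, 0) p))) => ->; exact: mPsi.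
have mB : mean (fun p => nrm (B p) ^+ 2) <= 4 * s ^+ 2.
  apply: (le_trans (mean_sum_noise phi01 c01 kappaE tphi kappa4 nD (leqnn n))).
  by rewrite nE -ck; apply: eqle; ring.
have mZ : mean Z <= n%:R * (s ^+ 2 + delta / 8).
  rewrite mean_sum//; apply: (le_trans (y := \sum_(l < n) (s ^+ 2 + delta / 8))); last first.
    by rewrite sumr_const card_ord mulr_natl.
  apply: ler_sum => l _; rewrite meanD//; last first.
    by apply: bmeasB => //; exact: bmeas_cst.
  have ln : l%:R <= n%:R :> R by rewrite ler_nat ltnW.
  apply: lerD.
    apply: (le_trans (mean_walk phi01 c01 tphi kappa4 nD (ltnW (ltn_ord l)))).
    have -> : s ^+ 2 = n%:R * c ^+ 2 by rewrite nE -ck; ring.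
    by apply: ler_wpM2r => //; exact: sqr_ge0.
  rewrite meanB//; last exact: bmeas_cst.
  rewrite mean_cst; have := mean_energy phi01 c01 tphi kappa4 tauE nD (ltnW (ltn_ord l)).
  rewrite -/(E l) => h; apply: (le_trans (y := l%:R * (2 * tau))); first by move: h; clear; lra.
  apply: (le_trans (y := n%:R * (2 * (delta / (16 * n%:R))))).
    have tau0 := tau_ge0 phi01 tphi tauE.
    by apply: ler_pM => //; [exact: mulr_ge0|rewrite ler_pM2l].
  by apply: eqle; field; rewrite lt0r_neq0.
have G0 p : 0 <= G p by rewrite addr_ge0 ?sqr_ge0// addr_ge0// mulr_ge0.
have mG : mean G <= delta.
  rewrite meanD//; [|exact: bmeas_nrm2|exact: bmeasD].
  rewrite meanD// meanZ//.
  have mZ' : 2 / n%:R * mean Z <= 2 * (s ^+ 2 + delta / 8).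
    rewrite -ler_pdivlMl ?divr_gt0// (le_trans mZ)//.
    by apply: eqle; field; rewrite lt0r_neq0.
  have ss : s ^+ 2 <= 2^-1 * (delta / 24) by rewrite expr2 ler_pM// ltW.
  by move: d0 mPsi' mB mZ' ss; clear; lra.
have wD w : (w < 2 ^ n)%N -> (2 * w.+1 <= D)%N.
  by move=> wn; rewrite /D mulnC; apply: leq_mul.
have wD' w : (w < 2 ^ n)%N -> (w < D)%N.
  by move=> wn; apply: leq_trans (wD _ wn); rewrite leq_pmull.
have D0 : 0 < D%:R :> R by rewrite ltr0n; apply: leq_trans nD; rewrite expn_gt0.
have Nr : 0 < N%:R :> R by rewrite ltr0n.
have slopeE w : (w < 2 ^ n)%N -> 
    slope D N w = (2 * D%:R - 2 * w%:R - 1) / (2 * D%:R * N%:R) :> R.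
  move=> wn; rewrite /slope !natrM; congr (_ / _).
  have w2 : (2 * w + 1 <= 2 * D)%N.
    by rewrite addn1 ltn_pmul2l// wD'.
  by rewrite -subnDA natrB// natrD !natrM opprD addrA.
have wr w : (w < 2 ^ n)%N -> 2 * (w%:R + 1) <= D%:R :> R.
  by move=> /wD; rewrite -(ler_nat R) natrM -(natr1 w).
exists (block_poly n D q c phi N), G, (2 ^ n)%N, N, (slope D N); split => //.
- by rewrite expn_gt0.
- exact: trig_block_poly.
- exact: block_poly_le1.
- by apply: bmeasD; [exact: bmeas_nrm2|exact: bmeasD].
- move=> w wn; rewrite slopeE//; have := wr _ wn; set x := w%:R => xD.
  have x0 : 0 <= x by exact: ler0n.
  rewrite natrM; apply/andP; split.
    rewrite ler_pdivlMr ?mulr_gt0//.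
    have -> : (3 * N%:R)^-1 * (2 * D%:R * N%:R) = 2 * D%:R / 3 :> R.
      by field; rewrite lt0r_neq0.
    by clear -xD x0; lra.
  rewrite ler_pdivrMr ?mulr_gt0//.
  have -> : N%:R^-1 * (2 * D%:R * N%:R) = 2 * D%:R :> R by field; rewrite lt0r_neq0.
  by clear -x0; lra.
- move=> w wn; rewrite slopeE//; have := wr _ wn; set x := w%:R => xD.
  have x0 : 0 <= x by exact: ler0n.
  have a0 : 0 < 2 * D%:R - 2 * x - 1 by clear -xD x0; lra.
  rewrite (_ : _ / _ = 2 * D%:R / (2 * D%:R - 2 * x - 1)); last first.
    by field; rewrite !lt0r_neq0.
  rewrite ler_pdivrMr//.
  have xm : (x + 1) * m.+2%:R <= D%:R.
    by rewrite /D natrM /x natr1 ler_pM2r ?ltr0n// ler_nat.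
  have mE : m.+2%:R = m.+1%:R + 1 :> R by rewrite natr1.
  have em : 1 <= eps * m.+1%:R by rewrite mulrC -ler_pdivrMr// mul1r ltW.
  have : (x + 1) * 1 <= (x + 1) * (eps * m.+1%:R) by rewrite ler_pM2l//; clear -x0; lra.
  have : eps * ((x + 1) * m.+2%:R) <= eps * D%:R by rewrite ler_pM2l.
  by rewrite mE; clear -e0; nra.
- move=> w wn; rewrite !slopeE//; last exact: ltnW.
  by rewrite ler_pM2r ?invr_gt0 ?mulr_gt0// -natr1; clear; lra.
- move=> p Gp.
  have B2 : nrm (B p) ^+ 2 < 1.
    have : 0 <= 2 / n%:R * Z p by rewrite mulr_ge0.
    by move: (Psi0 (chr (N%:Z, 0) p)) Gp; rewrite /G; clear; lra.
  have B1 : nrm (B p) <= 1 by rewrite -(expr_le1 (n := 2)) ?nrm_ge0// ltW.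
  have Z1 : Z p <= n%:R / 2.
    have : 2 / n%:R * Z p <= 1.
      by move: (sqr_ge0 (nrm (B p))) (Psi0 (chr (N%:Z, 0) p)) Gp; rewrite /G; clear; lra.
    by rewrite mulrAC ler_pdivrMr// mul1r; clear; lra.
  have P1 : eta <= `|complex.Re (chr (N%:Z, 0) p)|.
    rewrite leNgt; apply/negP => h.
    have := Psi1 _ (nrm_chr (N%:Z, 0) p) (ltW h).
    have : 0 <= 2 / n%:R * Z p by rewrite mulr_ge0.
    by move: (sqr_ge0 (nrm (B p))) Gp; rewrite /G; clear; lra.
  have [w wn hw] := large_prefix_sum q phi01 c01 kappa4 nD (chr (N%:Z, 0) p) p.
  exists w, (complex.Re (chr (N%:Z, 0) p * prefix_sum n D q c phi w p)); split => //.
    by rewrite (partial_sum_block_poly c01 tphi kappa4 nD nN)//; exact: wD'.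
  apply: le_trans hw; rewrite big_split/= -/(B p).
  pose A : R := \sum_(l < n) (1 - nrm (X l p) ^+ 2) * E l p.
  have -> : \sum_(l < n) (c * kappa * ((1 - nrm (X l p) ^+ 2) * E l p))%:C = (c * kappa * A)%:C.
    by rewrite /A mulr_sumr rmorph_sum.
  (* Each term satisfies [(1 - a) e >= 1 - a - (1 - e)], and [Z p] adds up these losses. *)
  have A1 : n%:R / 2 <= A.
    apply: (le_trans (y := n%:R - Z p)); first by move: Z1; clear; lra.
    have -> : n%:R = \sum_(l < n) 1 :> R by rewrite sumr_const card_ord.
    rewrite -sumrB ler_sum// => l _.
    have /andP[x0 x1] := X2 l p; have e1 := E1 l p.
    have : 0 <= nrm (X l p) ^+ 2 * (1 - E l p) by rewrite mulr_ge0// subr_ge0.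
    by clear; lra.
  rewrite mulrDr mulrC ReDc ReZc.
  have RB : `|complex.Re (chr (N%:Z, 0) p * B p)| <= 1.
    by rewrite (le_trans (ler_Re_nrm _))// Normc.normcM nrm_chr mul1r.
  have cA : c * 4^-1 * (n%:R / 2) <= c * kappa * A.
    by rewrite ler_pM ?mulr_ge0 ?(ltW c0) ?divr_ge0 ?ler_pM2l// ltW.
  (* The drift is at least [c * (1/4) * (n/2) * eta = eta s k / 8 >= |M| + 1]; the 1 pays for the
     noise. *)
  have big : `|M| + 1 <= `|c * kappa * A * complex.Re (chr (N%:Z, 0) p)|.
    rewrite normrM [X in X * _]ger0_norm; last first.
      by rewrite (le_trans _ cA)// !mulr_ge0 ?(ltW c0)// ltW.
    apply: (le_trans (y := c * 4^-1 * (n%:R / 2) * eta)); last first.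
      by rewrite ler_pM// ?(ltW eta0)// !mulr_ge0 ?(ltW c0)// ltW.
    have -> : c * 4^-1 * (n%:R / 2) * eta = 8^-1 * (eta * s * k%:R).
      by rewrite nE -ck; field.
    by rewrite -ler_pdivrMl ?invrK.
  have := ler_norm M; have := lerB_normD (c * kappa * A * complex.Re (chr (N%:Z, 0) p))
     (complex.Re (chr (N%:Z, 0) p * B p)).
  by move: big RB; clear; lra.
Qed.

End BlockExistence.

(** * Summation of a uniformly convergent series of blocks *)

Section Assembly.
Context {R : realType}.
Implicit Types (p : R * R) (i j k m n w : nat).

Local Notation chr := (@character R).
Local Notation nrm := (@Normc.normc R).

Lemma trig_continuous S (F : R * R -> R[i]) : trig S F ->
  continuous (fun p : R * R => complex.Re (F p) : R) /\
  continuous (fun p : R * R => complex.Im (F p) : R).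
Proof.
elim => [k _||F1 F2 _ [r1 i1] _ [r2 i2]|c F1 _ [r1 i1]].
- have cl : continuous (fun p : R * R => k.1%:~R * p.1 + k.2%:~R * p.2 : R).
    move=> p; apply: cvgD; apply: cvgM;
      [exact: cvg_cst|exact: cvg_fst|exact: cvg_cst|exact: cvg_snd].
  split => p.
    exact: (continuous_comp (cl p) (@continuous_cos R _)).
  exact: (continuous_comp (cl p) (@continuous_sin R _)).
- by split => p; exact: cvg_cst.
- split.
    rewrite (_ : (fun p => _) = fun p => complex.Re (F1 p) + complex.Re (F2 p)).
      by move=> p; apply: cvgD; [exact: r1|exact: r2].
    by apply/funext => p; rewrite ReDc.
  rewrite (_ : (fun p => _) = fun p => complex.Im (F1 p) + complex.Im (F2 p)).
    by move=> p; apply: cvgD; [exact: i1|exact: i2].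
  by apply/funext => p; rewrite ImDc.
- split.
    rewrite (_ : (fun p => _) = fun p => complex.Re c * complex.Re (F1 p) -
      complex.Im c * complex.Im (F1 p)).
      by move=> p; apply: cvgB; (apply: cvgM; [exact: cvg_cst|]); [exact: r1|exact: i1].
    by apply/funext => p; rewrite ReMc.
  rewrite (_ : (fun p => _) = fun p => complex.Re c * complex.Im (F1 p) +
    complex.Im c * complex.Re (F1 p)).
    by move=> p; apply: cvgD; (apply: cvgM; [exact: cvg_cst|]); [exact: i1|exact: r1].
  by apply/funext => p; rewrite ImMc.
Qed.

Lemma trig_biperiodic S (F : R * R -> R[i]) : trig S F -> biperiodic F.
Proof.
elim => [k _||F1 F2 _ e1 _ e2|c F1 _ e1] x y //.
- have sh (t : R) (a : int) : expi (t + a%:~R * (2 * pi)) = expi t.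
    by rewrite /expi cos_shift sin_shift.
  rewrite /character; split.
    by rewrite -[RHS](sh _ k.1); congr expi; rewrite /= mulrDr addrAC.
  by rewrite -[RHS](sh _ k.2); congr expi; rewrite /= mulrDr addrA.
- by have [-> ->] := e1 x y; have [-> ->] := e2 x y.
- by have [-> ->] := e1 x y.
Qed.

Lemma nrm_fourier_coef_le (u : R * R -> R) (B : R) (l : int * int) :
  bmeas u -> (forall p, `|u p| <= B) ->
  nrm (fourier_coef (fun p => (u p)%:C) l) <= B + B.
Proof.
move=> bu uB; rewrite fourier_coefE.
have le z : nrm z <= `|complex.Re z| + `|complex.Im z|.
  rewrite -ler_sqr ?nnegrE ?nrm_ge0 ?addr_ge0// sqr_nrm.
  rewrite -(real_normK (num_real (complex.Re z))) -(real_normK (num_real (complex.Im z))).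
  by rewrite sqrrD lerD2r lerDl mulrn_wge0// mulr_ge0.
have bF : cbmeas (fun p => (u p)%:C * chr (- l) p).
  by apply: cbmeasM; [split => //; exact: bmeas_cst|exact: cbmeas_chr].
have uF p : nrm ((u p)%:C * chr (- l) p) <= B.
  by rewrite Normc.normcM nrm_chr mulr1 nrm_real.
rewrite (le_trans (le _))// lerD// mean_norm_le//; try by case: bF.
  by move=> p; rewrite (le_trans (ler_Re_nrm _)).
by move=> p; rewrite (le_trans (ler_Im_nrm _)).
Qed.

Lemma fourier_coef_out S (F : R * R -> R[i]) (l : int * int) :
  trig S F -> ~ S l -> fourier_coef F l = 0.
Proof.
move=> tF Sl; rewrite fourier_coefE.
apply: (cmean_trig0 (S := [set k | S (k + l)])); first by rewrite /= add0r.
have tl : trig [set - l] (chr (- l)) by constructor.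
by apply: (trigM tF tl) => k _ Sk ->; rewrite /= subrK.
Qed.

Section Series.
Variables (P : nat -> R * R -> R).
Hypothesis tP : forall i, exists S, trig S (fun p => (P i p)%:C).
Hypothesis P1 : forall i p, `|P i p| <= 1.

Definition partial n p : R := \sum_(i < n) 2^-1 ^+ i.+1 * P i p.
(* The sum of the series: each [partial n p + 2^-n] is an upper bound of it. *)
Definition full_sum p : R := inf [set partial n p + 2^-1 ^+ n | n in setT].

Lemma partialS n p : partial n.+1 p = partial n p + 2^-1 ^+ n.+1 * P n p.
Proof. by rewrite /partial big_ord_recr. Qed.

Lemma half_gt0 n : 0 < 2^-1 ^+ n :> R.
Proof. by rewrite exprn_gt0. Qed.

Lemma partial_step n p : `|partial n.+1 p - partial n p| <= 2^-1 ^+ n - 2^-1 ^+ n.+1.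
Proof.
rewrite partialS addrAC subrr add0r normrM ger0_norm ?(ltW (half_gt0 _))//.
rewrite (_ : _ - _ = 2^-1 ^+ n.+1); first by rewrite ler_piMr// (ltW (half_gt0 _)).
by rewrite exprS; field.
Qed.

(** The bound is kept as a difference so that it telescopes. *)
Lemma partial_dist n m p : (n <= m)%N ->
  `|partial m p - partial n p| <= 2^-1 ^+ n - 2^-1 ^+ m.
Proof.
elim: m => [|m IH]; first by rewrite leqn0 => /eqP ->; rewrite !subrr normr0.
rewrite leq_eqVlt => /orP[/eqP ->|]; first by rewrite !subrr normr0.
rewrite ltnS => nm; have := IH nm; have := partial_step m p.
have := ler_normD (partial m.+1 p - partial m p) (partial m p - partial n p).
by rewrite addrA subrK; lra.
Qed.

Lemma full_sum_dist n p : `|full_sum p - partial n p| <= 2^-1 ^+ n.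
Proof.
(* Every lower estimate lies below every upper one, which places the infimum between the two
   estimates of index [n]. *)
have lb m : partial n p - 2^-1 ^+ n <= partial m p + 2^-1 ^+ m.
  have [nm|/ltnW mn] := leqP n m.
    by have := partial_dist p nm; have := half_gt0 m; rewrite ler_norml => ? /andP[]; lra.
  by have := partial_dist p mn; have := half_gt0 n; rewrite ler_norml => ? /andP[]; lra.
rewrite ler_distl; apply/andP; split.
  by apply: lb_le_inf => [|_ [m _ <-]]; [exists (partial 0 p + 2^-1 ^+ 0), 0%N|exact: lb].
apply: ge_inf; last by exists n.
by exists (partial n p - 2^-1 ^+ n) => _ [m _ <-]; exact: lb.
Qed.

Lemma full_sum_le1 p : `|full_sum p| <= 1.
Proof. by have := full_sum_dist 0 p; rewrite /partial big_ord0 subr0 expr0. Qed.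

Lemma half_small (e : R) : 0 < e -> exists n, 2^-1 ^+ n < e.
Proof.
move=> e0; have [|n ne] := @expr_lt_eventually R 2^-1 (e / 2) _ (divr_gt0 e0 (ltr0Sn _ 1)).
  by lra.
by exists n; lra.
Qed.

Lemma continuous_partial n : continuous (partial n).
Proof.
elim: n => [|n IH] p.
  rewrite (_ : partial 0 = fun=> 0); first exact: cvg_cst.
  by apply/funext => q; rewrite /partial big_ord0.
rewrite (_ : partial n.+1 = fun q => partial n q + 2^-1 ^+ n.+1 * P n q); last first.
  by apply/funext => q; rewrite partialS.
apply: cvgD; first exact: IH.
apply: cvgM; first exact: cvg_cst.
by have [S /trig_continuous[c _]] := tP n; exact: c.
Qed.

Lemma continuous_full_sum : continuous full_sum.
Proof.
move=> p; apply/cvgrPdist_lt => e e0.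
have [|n ne] := @half_small (e / 3); first by rewrite divr_gt0.
have /cvgrPdist_lt/(_ (e / 3)) := @continuous_partial n p.
move=> /(_ (divr_gt0 e0 (ltr0Sn _ 2))); apply: filterS => q pq.
have := full_sum_dist n p; have := full_sum_dist n q; move: pq.
by rewrite ltr_norml !ler_norml ltr_norml => /andP[? ?] /andP[? ?] /andP[? ?]; apply/andP; lra.
Qed.

Lemma biperiodic_full_sum : biperiodic full_sum.
Proof.
move=> x y.
have E n : partial n (x + 2 * pi, y) = partial n (x, y) /\
    partial n (x, y + 2 * pi) = partial n (x, y).
  split; apply: eq_bigr => i _; have [S /trig_biperiodic h] := tP i;
  by congr (_ * _); have [h1 h2] := h x y; apply: (@complexI R).
by rewrite /full_sum; split; congr inf; apply/seteqP; split => _ [n _ <-]; exists n => //;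
  rewrite ?(E n).1 ?(E n).2.
Qed.

Lemma bmeas_P i : bmeas (P i).
Proof. by have [S /cbmeas_trig[]] := tP i. Qed.

Lemma bmeas_partial n : bmeas (partial n).
Proof.
apply: bmeas_sum => i; apply: bmeasM; [exact: bmeas_cst|exact: bmeas_P].
Qed.

Lemma bmeas_full_sum : bmeas full_sum.
Proof.
split; last by exists 1; exact: full_sum_le1.
apply: (measurable_fun_cvg (h := partial)) => [n|p _]; first by have [] := bmeas_partial n.
apply/cvgrPdist_lt => e e0; have [n ne] := half_small e0.
exists n => // m /= nm; rewrite (le_lt_trans (full_sum_dist m p))// (le_lt_trans _ ne)//.
by rewrite ler_wiXn2l//; lra.
Qed.

Lemma cbmeas_real (u : R * R -> R) : bmeas u -> cbmeas (fun p => (u p)%:C).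
Proof. by move=> bu; split => //; exact: bmeas_cst. Qed.

(** Fourier coefficients pass to uniform limits, and those of the partial sums are constant from [n]
    on. *)
Lemma fourier_coef_full_sum n (l : int * int) :
  (forall i, (n <= i)%N -> fourier_coef (fun p => (P i p)%:C) l = 0) ->
  fourier_coef (fun p => (full_sum p)%:C) l = fourier_coef (fun p => (partial n p)%:C) l.
Proof.
move=> Pl; have bt := cbmeas_real bmeas_full_sum.
have Em m : (n <= m)%N -> fourier_coef (fun p => (partial m p)%:C) l =
    fourier_coef (fun p => (partial n p)%:C) l.
  elim: m => [|m IH]; first by rewrite leqn0 => /eqP ->.
  rewrite leq_eqVlt => /orP[/eqP -> //|]; rewrite ltnS => nm; rewrite -(IH nm).
  rewrite (_ : (fun p => (partial m.+1 p)%:C) =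
    fun p => (partial m p)%:C + (2^-1 ^+ m.+1)%:C * (P m p)%:C); last first.
    by apply/funext => p; rewrite partialS rmorphD rmorphM.
  rewrite fourier_coefD; [|exact/cbmeas_real/bmeas_partial|].
    by rewrite fourier_coefZ ?Pl ?mulr0 ?addr0//; exact/cbmeas_real/bmeas_P.
  by apply: cbmeasM; [exact: cbmeas_cst|exact/cbmeas_real/bmeas_P].
apply/eqP; rewrite -subr_eq0; apply/eqP; apply: Normc.eq0_normc.
apply/eqP; rewrite eq_le nrm_ge0 andbT; apply/ler_addgt0Pr => e e0.
rewrite add0r; have [|m me] := @half_small (e / 2); first by rewrite divr_gt0.
pose m' := maxn n m.
rewrite -(Em m' (leq_maxl _ _)).
have bm := cbmeas_real (bmeas_partial m').
have -> : fourier_coef (fun p => (full_sum p)%:C) l - fourier_coef (fun p => (partial m' p)%:C) l =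
    fourier_coef (fun p => (full_sum p - partial m' p)%:C) l.
  rewrite -mulN1r -fourier_coefZ// -fourier_coefD//; last first.
    by apply: cbmeasM => //; exact: cbmeas_cst.
  apply: (congr1 (fourier_coef^~ l)); apply/funext => p.
  by move: (full_sum p) (partial m' p) => x y; rewrite mulN1r -rmorphB.
apply: (le_trans (nrm_fourier_coef_le (B := 2^-1 ^+ m') _ _ _)).
- by apply: bmeasB; [exact: bmeas_full_sum|exact: bmeas_partial].
- by move=> p; exact: full_sum_dist.
have : 2^-1 ^+ m' <= 2^-1 ^+ m :> R by rewrite ler_wiXn2l ?leq_maxr//; lra.
by lra.
Qed.

End Series.

End Assembly.

(** * Interlaced blocks, the sequence of rhombi and divergence almost everywhere *)

Section Blocks.
Context {R : realType}.
Implicit Types (p : R * R) (i j k n w : nat).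

Local Notation nrm := (@Normc.normc R).

(** The block enters the series with the factor [2 ^- j.+1], which leaves [j + 2]; the earlier
    blocks, bounded by 1 in total, take away at most 1. *)
Definition level j : R := 2 ^+ j.+1 * j.+2%:R.
Definition tolerance j : R := j.+1%:R^-1.

Lemma blocks_exist : exists (P G : nat -> R * R -> R) (s N : nat -> nat) (b : nat -> nat -> R),
  forall j, (3 * N j <= N j.+1)%N /\
    exists N0, block_spec (level j) (2^-1 ^+ j) (tolerance j) N0 (P j) (G j) (s j) (N j) (b j).
Proof.
pose T := ((R * R -> R) * (R * R -> R) * nat * nat * (nat -> R))%type.
pose spec (jn : nat * nat) (x : T) := block_spec (level jn.1) (2^-1 ^+ jn.1)
  (tolerance jn.1) jn.2 x.1.1.1.1 x.1.1.1.2 x.1.1.2 x.1.2 x.2.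
have /choice[st stP] : forall jn, exists x, spec jn x.
  move=> [j n]; have [||P [G [s [N [b H]]]]] := 
    @block_exists R (level j) (2^-1 ^+ j) (tolerance j) n.
  - by rewrite exprn_gt0.
  - by rewrite /tolerance invr_gt0.
  - by exists (P, G, s, N, b).
(* Each block is chosen after the previous one, with three times the previous [N] as a lower bound
   for its own. *)
pose fix dat j : T := if j is j'.+1 then st (j, 3 * (dat j').1.2)%N else st (0, 0)%N.
exists (fun j => (dat j).1.1.1.1), (fun j => (dat j).1.1.1.2), (fun j => (dat j).1.1.2),
  (fun j => (dat j).1.2), (fun j => (dat j).2) => j; split.
  exact: block_N (stP (j.+1, 3 * (dat j).1.2)%N).
case: j => [|j]; first by exists 0%N; exact: (stP (0, 0)%N).
by exists (3 * (dat j).1.2)%N; exact: (stP (j.+1, (3 * (dat j).1.2)%N)).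
Qed.

Variables (P G : nat -> R * R -> R) (s N : nat -> nat) (b : nat -> nat -> R).
Hypothesis N_triple : forall j, (3 * N j <= N j.+1)%N.
Hypothesis blockP : forall j, exists N0,
  block_spec (level j) (2^-1 ^+ j) (tolerance j) N0 (P j) (G j) (s j) (N j) (b j).

Let f := full_sum P.

Lemma summand_trig i : exists S, trig S (fun p => (P i p)%:C).
Proof. by have [N0 /block_trig tPi] := blockP i; exists (annulus (N i) (3 * N i)). Qed.

Lemma summand_le1 i p : `|P i p| <= 1.
Proof. by have [N0 H] := blockP i; exact: block_le1 H p. Qed.

Lemma N_gt0 j : (0 < N j)%N.
Proof. by have [N0 H] := blockP j; exact: block_N_gt0 H. Qed.

Lemma N_homo i j : (i <= j)%N -> (N i <= N j)%N.
Proof.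
have step k : (N k <= N k.+1)%N by apply: leq_trans (N_triple k); rewrite leq_pmull.
exact: homo_leq leqnn leq_trans step i j.
Qed.

Lemma N_lt i j : (i < j)%N -> (3 * N i <= N j)%N.
Proof. by move=> ij; apply: leq_trans (N_triple i) (N_homo ij). Qed.

Lemma N_ge j : (j <= N j)%N.
Proof.
elim: j => // j IH; apply: leq_trans (N_triple j).
by have := N_gt0 j; lia.
Qed.

Lemma b_gt0 j w : (w < s j)%N -> 0 < b j w.
Proof.
have [N0 H] := blockP j => /(block_bounds H)/andP[+ _]; apply: lt_le_trans.
by rewrite invr_gt0 ltr0n muln_gt0/= N_gt0.
Qed.

Lemma Delta_sub (a1 b1 a2 b2 : R) : a2 <= a1 -> b2 <= b1 ->
  Delta a1 b1 `<=` Delta a2 b2.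
Proof.
move=> a12 b12 p; rewrite /Delta /=; apply: le_trans.
by apply: lerD; rewrite ler_wpM2r.
Qed.

Lemma block_Delta_lower j w p : (w < s j)%N -> `|p.1| + `|p.2| <= (N j)%:R ->
  Delta (N j)%:R^-1 (b j w) p.
Proof.
move=> ws h; have [N0 H] := blockP j; have /andP[_ b1] := block_bounds H ws.
apply: (@Delta_sub (N j)%:R^-1 (N j)%:R^-1) => //.
by rewrite /Delta /= -mulrDr ler_pdivrMl ?mulr1// ltr0n N_gt0.
Qed.

Lemma block_Delta_upper j w p : (w < s j)%N -> Delta (N j)%:R^-1 (b j w) p ->
  `|p.1| + `|p.2| <= (3 * N j)%N%:R.
Proof.
move=> ws h; have [N0 H] := blockP j; have /andP[b1 _] := block_bounds H ws.
have n0 : 0 < (3 * N j)%N%:R :> R by rewrite ltr0n muln_gt0/= N_gt0.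
have : Delta (3 * N j)%N%:R^-1 (3 * N j)%N%:R^-1 p.
  apply: Delta_sub h => //; rewrite lef_pV2 ?posrE// ?ltr0n ?N_gt0//.
  by rewrite ler_nat leq_pmull.
by rewrite /Delta /= -mulrDr ler_pdivrMl// mulr1.
Qed.

Lemma norm1_nat (k : int * int) :
  `|k.1%:~R| + `|k.2%:~R| = (absz k.1 + absz k.2)%N%:R :> R.
Proof. by rewrite natrD -!intr_norm -!abszE. Qed.

Lemma annulus_in i j w : (i < j)%N -> (w < s j)%N ->
  annulus (N i) (3 * N i) `<=` lattice (Delta (N j)%:R^-1 (b j w)).
Proof.
move=> ij ws k [_ k2]; apply: block_Delta_lower => //.
by rewrite /= norm1_nat ler_nat (leq_trans k2)// N_lt.
Qed.

Lemma lattice_notin_annulus i j w (k : int * int) : (j < i)%N -> (w < s j)%N ->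
  lattice (Delta (N j)%:R^-1 (b j w)) k -> ~ annulus (N i) (3 * N i) k.
Proof.
move=> ij ws /(block_Delta_upper ws); rewrite /= norm1_nat ler_nat => k1 [k2 _].
by have := leq_trans k2 k1; rewrite ltnNge N_lt.
Qed.

(** Earlier blocks have their spectra in the l1-ball of radius [N j], inside the rhombus; later ones
    start beyond [N j.+1 >= 3 * N j], outside it. *)
Lemma partial_sum_full_sum j w p : (w < s j)%N ->
  partial_sum (Delta (N j)%:R^-1 (b j w)) p (fun q => (f q)%:C) =
  (partial P j p)%:C + (2^-1 ^+ j.+1)%:C *
    partial_sum (Delta (N j)%:R^-1 (b j w)) p (fun q => (P j q)%:C).
Proof.
move=> ws; set D := Delta _ _.
have finD : finite_set (lattice D).
  by apply: finite_lattice_Delta; [rewrite invr_gt0 ltr0n N_gt0|exact: b_gt0].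
have E : partial_sum D p (fun q => (f q)%:C) = partial_sum D p (fun q => (partial P j.+1 q)%:C).
  apply: eq_fsbigr => k /set_mem kD; congr (_ * _).
  apply: (fourier_coef_full_sum summand_trig summand_le1) => i ji.
  have [N0 /block_trig tPi] := blockP i.
  by apply: (fourier_coef_out tPi); exact: lattice_notin_annulus kD.
have tpart : trig (lattice D) (fun q => (partial P j q)%:C).
  rewrite /partial; under eq_fun do rewrite rmorph_sum; apply: trig_sum => i _.
  under eq_fun do rewrite rmorphM; apply: trigZ.
  by have [N0 /block_trig] := blockP i; apply: trigS; exact: annulus_in.
have [S tPj] := summand_trig j.
rewrite E (_ : (fun q => (partial P j.+1 q)%:C) =
    fun q => (partial P j q)%:C + (2^-1 ^+ j.+1)%:C * (P j q)%:C); last first.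
  by apply/funext => q; rewrite partialS rmorphD rmorphM.
rewrite (partial_sumD finD _ (cbmeas_trig tpart) (cbmeas_trig (trigZ _ tPj))).
rewrite (partial_sum_in finD _ (@subset_refl _ _) tpart).
by rewrite (partial_sumZ finD _ _ (cbmeas_trig tPj)).
Qed.

Lemma large_partial_sum j p : G j p < 1 -> exists2 w, (w < s j)%N &
  j.+1%:R <= nrm (partial_sum (Delta (N j)%:R^-1 (b j w)) p (fun q => (f q)%:C)).
Proof.
move=> Gp; have [N0 H] := blockP j; have [w [t [ws E tM]]] := block_large H Gp.
exists w => //; rewrite partial_sum_full_sum// E -rmorphM -rmorphD nrm_real.
have F1 : `|partial P j p| <= 1.
  have := partial_dist summand_le1 p (leq0n j); rewrite /partial big_ord0 subr0 => h.
  by rewrite (le_trans h)// expr0 gerBl exprn_ge0.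
have : j.+2%:R <= `|2^-1 ^+ j.+1 * t|.
  rewrite normrM ger0_norm ?exprn_ge0// exprVn -ler_pdivrMl ?invr_gt0 ?exprn_gt0//.
  by rewrite invrK.
rewrite [partial P j p + _]addrC -(natr1 j.+1) => t2.
by have := lerB_normD (2^-1 ^+ j.+1 * t) (partial P j p); lra.
Qed.

(* The k-th region is the w-th one of the j-th chain, where pos k = (j, w). *)
Fixpoint pos k : nat * nat :=
  if k is k'.+1 then
    if ((pos k').2.+1 < s (pos k').1)%N then ((pos k').1, (pos k').2.+1)
    else ((pos k').1.+1, 0%N)
  else (0%N, 0%N).

Lemma chain_gt0 j : (0 < s j)%N.
Proof. by have [N0 H] := blockP j; exact: block_size H. Qed.

Lemma pos_lt k : ((pos k).2 < s (pos k).1)%N.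
Proof.
elim: k => [|k IH]; first exact: chain_gt0.
by rewrite [pos k.+1]/=; case: ifP => // _; exact: chain_gt0.
Qed.

Lemma pos_le k : ((pos k).1 <= k)%N.
Proof.
by elim: k => //= k IH; case: ifP => //= _; exact: leqW.
Qed.

Lemma pos_homo i k : (i <= k)%N -> ((pos i).1 <= (pos k).1)%N.
Proof.
have step n : ((pos n).1 <= (pos n.+1).1)%N by rewrite /=; case: ifP.
exact: (@homo_leq _ (fun n => (pos n).1) leq leqnn leq_trans step i k).
Qed.

Lemma pos_surj j w : (w < s j)%N -> exists k, pos k = (j, w).
Proof.
have step i n : (exists k, pos k = (i, 0%N)) -> (n < s i)%N -> exists k, pos k = (i, n).
  move=> i0; elim: n => // n IH ni; have [k kE] := IH (ltnW ni).
  by exists k.+1; rewrite /= kE /= ni.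
move=> wj; apply: (step) => //; elim: j {w wj} => [|j IH]; first by exists 0%N.
have [|k kE] := step j (s j).-1 IH; first by rewrite prednK ?chain_gt0.
by exists k.+1; rewrite /= kE /= prednK ?chain_gt0// ltnn.
Qed.

Definition aseq k : R := (N (pos k).1)%:R^-1.
Definition bseq k : R := b (pos k).1 (pos k).2.

Lemma aseq_gt0 k : 0 < aseq k.
Proof. by rewrite /aseq invr_gt0 ltr0n N_gt0. Qed.

Lemma bseq_gt0 k : 0 < bseq k.
Proof. exact/b_gt0/pos_lt. Qed.

Lemma aseq_le k : aseq k.+1 <= aseq k.
Proof.
rewrite /aseq lef_pV2 ?posrE ?ltr0n ?N_gt0// ler_nat.
by apply: N_homo; exact: pos_homo.
Qed.

(** From one chain to the next, [b <= 1 / N] for the new chain and [b >= 1 / (3 N)] for the old one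
    suffice because [N] at least triples. *)
Lemma bseq_le k : bseq k.+1 <= bseq k.
Proof.
have := pos_lt k; rewrite /bseq [pos k.+1]/=.
move: (pos k) => [j w] /= ws; case: ifP => [ws'|_] /=.
  by have [N0 H] := blockP j; exact: block_mono H _ ws'.
have [N0 H] := blockP j; have [N0' H'] := blockP j.+1.
have /andP[b1 _] := block_bounds H ws.
have /andP[_ b2] := block_bounds H' (chain_gt0 _).
rewrite (le_trans b2)// (le_trans _ b1)//.
by rewrite lef_pV2 ?posrE ?ltr0n ?muln_gt0 ?N_gt0// ler_nat.
Qed.

Lemma pos_ge j : exists k0, forall k, (k0 <= k)%N -> (j <= (pos k).1)%N.
Proof.
have [k0 kE] := pos_surj (chain_gt0 j); exists k0 => k kk.
by have := pos_homo kk; rewrite kE.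
Qed.

Lemma rho_cvg : rho_Delta (aseq k) (bseq k) @[k --> \oo] --> (1 : R).
Proof.
apply/cvgrPdist_lt => e e0.
have [k0 kP] := pos_ge (Num.truncn e^-1).
exists k0 => // k /= /kP jk.
have [N0 H] := blockP (pos k).1.
have /andP[_ ba] := block_bounds H (pos_lt k); have r1 := block_rho H (pos_lt k).
rewrite /rho_Delta max_l// min_r//.
have : 1 <= aseq k / bseq k by rewrite ler_pdivlMr ?mul1r// bseq_gt0.
have : tolerance (pos k).1 < e.
  rewrite /tolerance -(invrK e) ltf_pV2 ?posrE ?invr_gt0//.
  by rewrite (lt_le_trans (truncnS_gt _))// ler_nat.
rewrite /aseq /bseq => t1 t2; rewrite distrC ger0_norm ?subr_ge0//.
by lra.
Qed.

Lemma complete_seq : complete_regions (fun k => Delta (aseq k) (bseq k)).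
Proof.
apply/seteqP; split => // p _.
pose j := (Num.truncn (`|p.1| + `|p.2|)).+1.
have [k kE] := pos_surj (chain_gt0 j); exists k => //.
rewrite /aseq /bseq kE; apply: block_Delta_lower; first exact: chain_gt0.
rewrite (le_trans (ltW (truncnS_gt _)))// ler_nat.
by apply: leq_trans (N_ge j).
Qed.

Lemma limn_esup_pinfty (u : nat -> R) :
  (forall M n, exists2 k, (n <= k)%N & M <= u k) ->
  limn_esup (fun k => (u k)%:E) = +oo%E.
Proof.
move=> H; rewrite /limn_esup limf_esupE.
apply/ereal_inf_pinfty => _ [V [n _ nV] <-]; apply: eq_infty => M.
have [k nk Mk] := H M n.
apply: (le_trans (y := (u k)%:E)); first by rewrite lee_fin.
by apply: ereal_sup_ubound; exists k => //; exact: nV.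
Qed.

Lemma ae_divergence : {ae lebesgue2, forall p : R * R, torus p ->
  limn_esup (fun k => (nrm (partial_sum (Delta (aseq k) (bseq k)) p
    (fun q => (f q)%:C)))%:E) = +oo%E}.
Proof.
pose B j : set (R * R) := torus `&` [set p | (1%:E <= `|(G j p)%:E|)%E].
have bG j : bmeas (G j) by have [N0 H] := blockP j; exact: block_bmeas H.
have G0 j p : 0 <= G j p by have [N0 H] := blockP j; exact: block_ge0 H p.
have mG j : measurable_fun torus (EFin \o G j).
  by apply/measurable_EFinP; apply: measurable_funTS; have [] := bG j.
have mB j : measurable (B j).
  apply: emeasurable_fun_c_infty; first exact: measurable_torus.
  by apply: measurableT_comp => //; exact: mG.
have pi2 : 0 < 4 * pi ^+ 2 :> R by rewrite mulr_gt0// exprn_gt0// pi_gt0.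
(* Markov's inequality for [G j], whose mean is at most [2 ^- j]. *)
have muB j : (lebesgue2 (B j) <= (4 * pi ^+ 2 * 2^-1 ^+ j)%:E)%E.
  have := @le_integral_abse _ _ R lebesgue2 torus measurable_torus _ 1 (mG j) ltr01.
  rewrite mul1e; move/le_trans; apply.
  under eq_integral do rewrite /= ger0_norm//.
  have fi := bmeas_integrable (bG j).
  rewrite -[leLHS]fineK; last first.
    by apply: integrable_fin_num; [exact: measurable_torus|exact: fi].
  rewrite lee_fin -ler_pdivrMl//.
  by have [N0 H] := blockP j; exact: block_mean H.
exists (lim_sup_set B); split.
- by apply: bigcap_measurable => // k _; apply: bigcup_measurable => i _; exact: mB.
- apply: lim_sup_set_cvg0 => //.
  apply: (@le_lt_trans _ _ (4 * pi ^+ 2 * 2)%:E); last exact: ltry.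
  apply: lime_le; first exact: is_cvg_nneseries.
  apply: nearW => n; apply: (le_trans (lee_sum _ (fun j _ => muB j))).
  rewrite sumEFin lee_fin -mulr_sumr ler_pM2l// big_mkord.
  have -> : \sum_(i < n) 2^-1 ^+ i = 2 - 2 * 2^-1 ^+ n :> R.
    elim: n => [|n IH]; first by rewrite big_ord0 expr0 mulr1 subrr.
    by rewrite big_ord_recr/= IH exprS; field.
  by rewrite gerBl mulr_ge0// exprn_ge0.
move=> p /= /not_implyP[tp np] n _.
apply: contrapT => nB; apply: np.
apply: limn_esup_pinfty => M m.
(* Beyond [n], the point [p] avoids the exceptional sets; [j >= m] suffices because a region of
   chain [j] has index at least [j]; the last bound gives [M <= j + 1]. *)
pose j := (maxn (maxn n m) (Num.truncn M)).
have nj : (n <= j)%N by rewrite /j !leq_max leqnn.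
have mj : (m <= j)%N by rewrite /j !leq_max leqnn orbT.
have Mj : M <= j.+1%:R.
  rewrite (le_trans (ltW (truncnS_gt M)))// ler_nat ltnS.
  by rewrite /j leq_max leqnn orbT.
have Gj : G j p < 1.
  rewrite ltNge; apply/negP => G1; apply: nB; exists j => //; split => //=.
  by rewrite lee_fin ger0_norm.
have [w ws large] := large_partial_sum Gj.
have [k kE] := pos_surj ws; exists k.
  by apply: leq_trans mj _; have := pos_le k; rewrite kE.
by rewrite (le_trans Mj)// /aseq /bseq kE.
Qed.

Lemma divergent_full_sum : exists (g : R * R -> R) (a b' : nat -> R),
    [/\ continuous g /\ biperiodic g,
        forall k, 0 < a k /\ 0 < b' k,
        complete_regions (fun k => Delta (a k) (b' k)),
        forall k, Delta (a k) (b' k) `<=` Delta (a k.+1) (b' k.+1) &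
        rho_Delta (a k) (b' k) @[k --> \oo] --> (1 : R)] /\
    {ae lebesgue2, forall p : R * R, torus p ->
      limn_esup (fun k => (Normc.normc
        (partial_sum (Delta (a k) (b' k)) p (fun q => (g q)%:C)))%:E)
      = +oo%E}.
Proof.
exists f, aseq, bseq; split; last exact: ae_divergence.
split.
- by split; [exact: continuous_full_sum summand_trig summand_le1|exact: biperiodic_full_sum summand_trig].
- by move=> k; split; [exact: aseq_gt0|exact: bseq_gt0].
- exact: complete_seq.
- by move=> k; apply: Delta_sub; [exact: aseq_le|exact: bseq_le].
- exact: rho_cvg.
Qed.

End Blocks.

Theorem theorem1 (R : realType) :
  exists (f : R * R -> R) (a b : nat -> R),
    [/\ continuous f /\ biperiodic f,
        forall k, 0 < a k /\ 0 < b k,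
        complete_regions (fun k => Delta (a k) (b k)),
        forall k, Delta (a k) (b k) `<=` Delta (a k.+1) (b k.+1) &
        rho_Delta (a k) (b k) @[k --> \oo] --> (1 : R)] /\
    {ae lebesgue2, forall p : R * R, torus p ->
      limn_esup (fun k => (Normc.normc
        (partial_sum (Delta (a k) (b k)) p (fun q => (f q)%:C)))%:E)
      = +oo%E}.
Proof.
have [P [G [s [N [b H]]]]] := @blocks_exist R.
exact: divergent_full_sum (fun j => (H j).1) (fun j => (H j).2).
Qed.
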